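(* Any misaligned $r$-round (possibly randomized) protocol, where $r=o(\sqrt m)$, solving $\mathsf{BHPC}_{m,r}$ correctly with constant probability requires $\Omega(m^2/r)$ bits of communication.
   Context: Let $\mathcal X=\{x_1,\dots,x_m\}$ and $\mathcal Y=\{y_1,\dots,y_m\}$ be disjoint universes. In $\mathsf{BHPC}_{m,r}$ (Boolean Hidden Pointer Chasing) there are four players $P_A,P_B,P_C,P_D$. For each $x\in\mathcal X$, $P_A$ holds $A_x\subseteq\mathcal Y$ and $P_B$ holds $B_x\subseteq\mathcal Y$ with the promise $A_x\cap B_x=\{t_x\}$ for a single element $t_x$; set $f_{AB}(x)=t_x$. For each $y\in\mathcal Y$, $P_C$ holds $C_y\subseteq\mathcal X$ and $P_D$ holds $D_y\subseteq\mathcal X$ with $C_y\cap D_y=\{t_y\}$; set $f_{CD}(y)=t_y$. Define $z_0=x_1$, $z_1=f_{AB}(z_0)$, $z_2=f_{CD}(z_1)$, $z_3=f_{AB}(z_2)$, etc. The goal is to output $b(z_r)=i\bmod 2$ where $z_r=x_i$ (if $r$ even) or $z_r=y_i$ (if $r$ odd). An $r$-round protocol organizes communication into rounds $1,\dots,r$: one pair ($\{P_A,P_B\}$ or $\{P_C,P_D\}$) communicates among themselves in odd rounds and the other pair in even rounds; each round ends with the speaking pair sending a message to the other pair. The protocol is misaligned if $P_C,P_D$ speak in the odd rounds and $P_A,P_B$ in the even rounds. *)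

(* Defs.v *)
From HB Require Import structures.
From mathcomp Require Import all_boot all_order all_algebra.
From mathcomp Require Import all_classical all_reals all_analysis.

Set Implicit Arguments.
Unset Strict Implicit.
Unset Printing Implicit Defensive.

Import Order.TTheory GRing.Theory Num.Theory.
Import numFieldNormedType.Exports.

Local Open Scope classical_set_scope.
Local Open Scope ring_scope.

(* Both universes X = {x_1, .., x_m} and Y = {y_1, .., y_m} are represented by
   'I_m, the ordinal i standing for x_(i+1), resp. y_(i+1). A player's input is
   a family of subsets of one universe indexed by the other. *)
Definition family (m : nat) := {ffun 'I_m -> {set 'I_m}}.

(* The pointers f_AB and f_CD are fields: the promise determines them. *)
Record bhpc (m : nat) := Bhpc {
  inA : family m;
  inB : family m;
  inC : family m;
  inD : family m;
  fAB : 'I_m -> 'I_m;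
  fCD : 'I_m -> 'I_m;
  promiseAB : forall x, inA x :&: inB x = [set fAB x]%SET;
  promiseCD : forall y, inC y :&: inD y = [set fCD y]%SET
}.

Section pointer_chasing.
Variables (m : nat) (m_gt0 : (0 < m)%N) (I : bhpc m).

Fixpoint pointer (k : nat) : 'I_m :=
  match k with
  | 0 => Ordinal m_gt0
  | j.+1 => if odd j then fCD I (pointer j) else fAB I (pointer j)
  end.

(* The successor is due to the shift of indices. *)
Definition bhpc_answer (r : nat) : bool := odd (pointer r).+1.

End pointer_chasing.

(* One round of a speaking pair whose two players have inputs in T. In
   [Say s f next], one player of the pair (the first if s, else the second)
   sends its partner the bit f(input), and the round goes on with [next] of
   that bit. In [Send s f next], such a player ends the round by sending the
   other pair the message f(input), and [next] of that message is what the
   speaking pair does afterwards. Only [Send] is seen by the other pair.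
   Messages need not be self-delimiting. *)
Inductive round (T L : Type) : Type :=
| Say of bool & (T -> bool) & (bool -> round T L)
| Send of bool & (T -> seq bool) & (seq bool -> L).

(* The behaviour of a pair during the last k rounds: what its two players know
   in common is the path followed so far in the strategy. When no round is
   left, either player can compute an answer from its input. *)
Fixpoint strategy (T : Type) (k : nat) (speaking : bool) : Type :=
  match k with
  | 0 => bool -> T -> bool
  | j.+1 => if speaking then round T (strategy T j false)
            else seq bool -> strategy T j true
  end.

Definition select (T : Type) (s : bool) (inputs : T * T) : T :=
  if s then inputs.1 else inputs.2.

(* The number of bits sent, the message to the other pair, and the rest of the
   strategy. *)
Fixpoint run_round (T L : Type) (inputs : T * T) (t : round T L) :
    nat * seq bool * L :=
  match t with
  | Say s f next =>
      let: (n, w, l) := run_round inputs (next (f (select s inputs))) in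
      (n.+1, w, l)
  | Send s f next =>
      let w := f (select s inputs) in (size w, w, next w)
  end.

Inductive player := PA | PB | PC | PD.

(* The total number of bits sent and the answer of each player, when the pair
   to speak in the next round is P_C, P_D if [cd], and P_A, P_B otherwise. *)
Fixpoint run (T : Type) (ab cd : T * T) (k : nat) (cd_speaks : bool) :
    strategy T k (~~ cd_speaks) -> strategy T k cd_speaks ->
    nat * (player -> bool) :=
  match k return strategy T k (~~ cd_speaks) -> strategy T k cd_speaks ->
                 nat * (player -> bool) with
  | 0 => fun sAB sCD =>
      (0%N, fun q => match q with
                     | PA => sAB true ab.1
                     | PB => sAB false ab.2
                     | PC => sCD true cd.1
                     | PD => sCD false cd.2
                     end)
  | j.+1 =>
      if cd_speaks as b return strategy T j.+1 (~~ b) -> strategy T j.+1 b ->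
                               nat * (player -> bool)
      then fun sAB sCD =>
        let: (n, w, sCD') := run_round cd sCD in
        let: (n', out) := @run T ab cd j false (sAB w) sCD' in
        ((n + n')%N, out)
      else fun sAB sCD =>
        let: (n, w, sAB') := run_round ab sAB in
        let: (n', out) := @run T ab cd j true sAB' (sCD w) in
        ((n + n')%N, out)
  end.

(* Deterministic r-round protocols; [cd_first] tells which pair speaks in the
   odd rounds. The output is the answer of a designated player, who may belong
   to either pair. *)
Record protocol (m r : nat) (cd_first : bool) := Protocol {
  strategyAB : strategy (family m) r (~~ cd_first);
  strategyCD : strategy (family m) r cd_first;
  output_player : player
}.

Definition misaligned_protocol (m r : nat) := protocol m r true.

Section execution.
Variables (m r : nat) (cd_first : bool).
Variables (Q : protocol m r cd_first) (I : bhpc m).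

Definition execution : nat * (player -> bool) :=
  run (inA I, inB I) (inC I, inD I) (strategyAB Q) (strategyCD Q).

Definition bits : nat := execution.1.

Definition output : bool := execution.2 (output_player Q).

End execution.

(* A randomized protocol is a random deterministic protocol, i.e., all players
   see the coins w : Om; private coins are a special case. *)
Section randomized.
Variables (R : realType) (m r : nat) (cd_first : bool).
Variables (d : measure_display) (Om : measurableType d).
Variable Q : Om -> protocol m r cd_first.

Definition solves_bhpc (m_gt0 : (0 < m)%N) (P : probability Om R) (p : R) :=
  forall I : bhpc m,
    let success := [set w | output (Q w) I = bhpc_answer m_gt0 I r] in
    measurable success /\ (p%:E <= P success)%E.

(* Worst case over the inputs and the coins. *)
Definition comm_cost : \bar R :=
  ereal_sup (range (fun wI : Om * bhpc m => ((bits (Q wI.1) wI.2)%:R : R)%:E)).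

End randomized.

(* Main.v *)
(* The inputs are random: both pointer functions are uniform, every coordinate
   (x, i) gets a random owner among the two players of its pair, the owner puts i
   into its set at x with probability 1/2, the other player does not, and finally
   the value of the pointer function is planted into both sets.

   Given the owners, the two inputs of a pair are independent. Compare the leaf
   distributions for the pointer functions F and F[x -> k] with the one for inputs
   with both F x and k planted at x. By cut and paste (Hellinger distance on
   rectangles) this costs no more than changing a single bit of a single player,
   and the level-one inequality bounds the sum of all such costs by O(C), where C
   is the number of bits sent. Hence, given the transcript, a uniformly random row
   of m candidates for a pointer is O(C/m^2)-close to uniform in squared Hellinger
   distance.

   A misaligned protocol needs the pointer at z_j of a pair that did not speak
   since z_j became known. If z_j were uniform, the average above would apply;
   instead one follows the probability that z_j lies in the part of its
   conditional distribution exceeding twice the uniform one. This probability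
   grows by O(C/m^2 + r/m) in each round, the second term being due to repeated
   vertices, so z_r is O(rC/m^2 + r^2/m)-close to uniform at the end, and its
   parity can be guessed only if rC is of order m^2. *)

Require Import Defs.
From HB Require Import structures.
From mathcomp Require Import all_boot all_order all_algebra.
From mathcomp Require Import all_classical all_reals all_analysis.
From mathcomp Require Import measurable_realfun zify ring lra.

Set Implicit Arguments.
Unset Strict Implicit.
Unset Printing Implicit Defensive.

Import Order.TTheory GRing.Theory Num.Theory.
Import numFieldNormedType.Exports.

Local Open Scope classical_set_scope.
Local Open Scope ring_scope.

(** Locked so that the deeply nested averages below are not unfolded by conversion. The average over
    an empty type is 0. *)
HB.lock Definition mean (R : realType) (T : finType) (f : T -> R) : R :=
  (\sum_t f t) / #|T|%:R.

(** * Averages over finite types *)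

Section mean.
Variables (R : realType) (T : finType).
Implicit Types f g : T -> R.

Lemma meanE f : mean f = (\sum_t f t) / #|T|%:R.
Proof. by rewrite mean.unlock. Qed.

Lemma eq_mean f g : f =1 g -> mean f = mean g.
Proof. by move=> fg; rewrite !meanE (eq_bigr _ (fun t _ => fg t)). Qed.

Lemma mean_ge0 f : (forall t, 0 <= f t) -> 0 <= mean f.
Proof. by move=> f0; rewrite meanE divr_ge0 ?ler0n// sumr_ge0. Qed.

Lemma ler_mean f g : (forall t, f t <= g t) -> mean f <= mean g.
Proof. by move=> fg; rewrite !meanE ler_wpM2r ?invr_ge0 ?ler0n// ler_sum. Qed.

Lemma meanD f g : mean (fun t => f t + g t) = mean f + mean g.
Proof. by rewrite !meanE big_split mulrDl. Qed.

Lemma meanZ c f : mean (fun t => c * f t) = c * mean f.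
Proof. by rewrite !meanE -mulr_sumr mulrA. Qed.

Lemma meanZr c f : mean (fun t => f t * c) = mean f * c.
Proof. by rewrite mulrC -meanZ; apply: eq_mean => t; rewrite mulrC. Qed.

Lemma mean_sum (J : Type) (r : seq J) (P : pred J) (f : J -> T -> R) :
  mean (fun t => \sum_(j <- r | P j) f j t) = \sum_(j <- r | P j) mean (f j).
Proof.
by rewrite meanE exchange_big mulr_suml; apply: eq_bigr => j _; rewrite meanE.
Qed.

Lemma mean_le_const c f : 0 <= c -> (forall t, f t <= c) -> mean f <= c.
Proof.
move=> c0 fc; have [T0|T0] := posnP #|T|.
  by rewrite !meanE T0 invr0 mulr0.
rewrite !meanE ler_pdivrMr ?ltr0n// (le_trans (ler_sum _ (fun t _ => fc t)))//.
by rewrite sumr_const -[X in X <= _]mulr_natr.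
Qed.

Lemma mean0 f : (forall t, f t = 0) -> mean f = 0.
Proof. by move=> f0; rewrite meanE big1 ?mul0r. Qed.

Lemma mean_const (c : R) : (0 < #|T|)%N -> mean (fun _ : T => c) = c.
Proof.
by move=> T0; rewrite !meanE sumr_const -[X in X / _]mulr_natr mulfK// pnatr_eq0 -lt0n.
Qed.

End mean.

Section mean2.
Variables (R : realType) (T U : finType).

Lemma mean_pair (f : T -> U -> R) :
  mean (fun t => mean (f t)) = mean (fun p : T * U => f p.1 p.2).
Proof.
rewrite !meanE (eq_bigr _ (fun t _ => meanE (f t))) -mulr_suml pair_bigA.
by rewrite card_prod natrM invfM -!mulrA; congr (_ * _); rewrite mulrC.
Qed.

Lemma mean_prod (f : T -> R) (g : U -> R) :
  mean (fun t => mean (fun u => f t * g u)) = mean f * mean g.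
Proof.
rewrite -meanZr; apply: eq_mean => t; exact: meanZ.
Qed.

Lemma mean_bij (h : T -> U) (f : U -> R) : bijective h ->
  mean f = mean (f \o h).
Proof.
move=> [k hk kh]; rewrite !meanE (bij_eq_card (Bijective hk kh)); congr (_ / _).
by rewrite (reindex h)//; exists k => ? _; [exact: hk|exact: kh].
Qed.

End mean2.

Lemma mean_exchange (R : realType) (T U : finType) (f : T -> U -> R) :
  mean (fun t => mean (f t)) = mean (fun u => mean (f ^~ u)).
Proof.
rewrite !mean_pair (@mean_bij _ (T * U)%type (U * T)%type (fun p => (p.2, p.1)))//.
by exists (fun p => (p.2, p.1)) => -[].
Qed.


(** * Resampling one value of a random function *)

Section resampling.
Variables (R : realType) (D V : finType).
Implicit Types (F : {ffun D -> V}) (x : D) (k : V).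

Definition upd F x k : {ffun D -> V} := [ffun y => if y == x then k else F y].

Lemma upd_same F x k : upd F x k x = k. Proof. by rewrite ffunE eqxx. Qed.

Lemma updK F x k : upd (upd F x k) x (F x) = F.
Proof. by apply/ffunP => y; rewrite !ffunE; case: eqP => // ->. Qed.

Lemma upd_id F x : upd F x (F x) = F.
Proof. by apply/ffunP => y; rewrite !ffunE; case: eqP => // ->. Qed.

Lemma upd_upd F x k l : upd (upd F x k) x l = upd F x l.
Proof. by apply/ffunP => y; rewrite !ffunE; case: eqP. Qed.

(** The map sending (F, k) to (F[x -> k], F x) is an involution. *)
Lemma sum_upd_swap x (g : {ffun D -> V} -> V -> R) :
  \sum_F \sum_k g F k = \sum_F \sum_k g (upd F x k) (F x).
Proof.
rewrite !pair_bigA /=.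
pose h (p : {ffun D -> V} * V) := (upd p.1 x p.2, p.1 x).
rewrite (reindex h)//=.
have hK : cancel h h by case=> F k; rewrite /h /= updK upd_same.
by exists h => ? _; apply: hK.
Qed.

Lemma mean_upd_swap x (g : {ffun D -> V} -> V -> R) :
  mean (fun F => \sum_k g F k) = mean (fun F => \sum_k g (upd F x k) (F x)).
Proof. by rewrite !meanE (@sum_upd_swap x). Qed.

Lemma mean_resample x (g : {ffun D -> V} -> R) :
  mean g = mean (fun F => mean (fun k => g (upd F x k))).
Proof.
have [F0|V0] := posnP #|{ffun D -> V}|; first by rewrite !meanE F0 invr0 !mulr0.
have {V0} V0 : (0 < #|V|)%N by move/card_gt0P: V0 => [F _]; apply/card_gt0P; exists (F x).
have /= swap := @sum_upd_swap x (fun F (_ : V) => g F).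
rewrite !meanE (eq_bigr _ (fun F _ => meanE (fun k => g (upd F x k)))).
rewrite -mulr_suml -swap; congr (_ / _).
under [in RHS]eq_bigr do rewrite sumr_const -[_ *+ _]mulr_natr.
by rewrite -mulr_suml mulfK// pnatr_eq0 -lt0n.
Qed.

(** Turns conditioning on F x = k into planting k at x, so that different values k are compared by
    averages over the same F. *)
Lemma mean_preim x k (g : {ffun D -> V} -> R) :
  mean (fun F => (F x == k)%:R * g F) = #|V|%:R^-1 * mean (fun F => g (upd F x k)).
Proof.
rewrite (@mean_resample x) -meanZ; apply: eq_mean => F.
rewrite !meanE (bigD1 k)//= upd_same eqxx mul1r big1 ?addr0 1?mulrC// => l lk.
by rewrite upd_same (negbTE lk) mul0r.
Qed.

End resampling.

(** * Squared Hellinger distance *)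

(** The contribution of one outcome to the squared Hellinger distance; it is summed over leaves
    below. *)
HB.lock Definition sqdist (R : realType) (p q : R) : R :=
  (Num.sqrt p - Num.sqrt q) ^+ 2.

Section sqdist.
Variable R : realType.
Implicit Types p q c : R.

Lemma sqdistEsqr p q : sqdist p q = (Num.sqrt p - Num.sqrt q) ^+ 2.
Proof. by rewrite sqdist.unlock. Qed.

Lemma sqdist_ge0 p q : 0 <= sqdist p q. Proof. by rewrite sqdistEsqr sqr_ge0. Qed.

Lemma sqdistC p q : sqdist p q = sqdist q p.
Proof. by rewrite !sqdistEsqr -sqrrN opprB. Qed.

Lemma sqdistxx p : sqdist p p = 0.
Proof. by rewrite !sqdistEsqr subrr expr0n. Qed.

Lemma sqdist_tri (t p q : R) : sqdist p q <= 2 * sqdist p t + 2 * sqdist t q.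
Proof.
rewrite !sqdistEsqr.
have := sqr_ge0 (Num.sqrt p - Num.sqrt t - (Num.sqrt t - Num.sqrt q)).
rewrite !expr2; lra.
Qed.

Lemma sqdistE p q : 0 <= p -> 0 <= q ->
  sqdist p q = p + q - 2 * Num.sqrt (p * q).
Proof.
move=> p0 q0; rewrite !sqdistEsqr sqrtrM// sqrrB !sqr_sqrtr//.
by rewrite -mulr_natl; ring.
Qed.

Lemma sqdist_le p q : 0 <= p -> 0 <= q -> sqdist p q <= p + q.
Proof.
by move=> p0 q0; rewrite sqdistE// gerBl mulr_ge0// sqrtr_ge0.
Qed.

Lemma sqdistMl c p q : 0 <= c -> sqdist (c * p) (c * q) = c * sqdist p q.
Proof.
by move=> c0; rewrite !sqdistEsqr !sqrtrM// -mulrBr exprMn sqr_sqrtr.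
Qed.

Lemma sqdistMr c p q : 0 <= c -> sqdist (p * c) (q * c) = sqdist p q * c.
Proof. by move=> c0; rewrite ![_ * c]mulrC sqdistMl. Qed.

(** By Cauchy-Schwarz. Merging two outcomes cannot increase the distance. *)
Lemma sqdistD (p q p' q' : R) : 0 <= p -> 0 <= q -> 0 <= p' -> 0 <= q' ->
  sqdist (p + p') (q + q') <= sqdist p q + sqdist p' q'.
Proof.
move=> p0 q0 p'0 q'0; rewrite !sqdistE ?addr_ge0//.
suff : Num.sqrt (p * q) + Num.sqrt (p' * q') <=
       Num.sqrt ((p + p') * (q + q')) by lra.
rewrite -(ler_pXn2r (n := 2))// ?nnegrE ?addr_ge0 ?sqrtr_ge0//.
rewrite sqr_sqrtr ?mulr_ge0 ?addr_ge0// sqrrD !sqr_sqrtr ?mulr_ge0//.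
rewrite !sqrtrM//.
have := sqr_ge0 (Num.sqrt p * Num.sqrt q' - Num.sqrt p' * Num.sqrt q).
rewrite sqrrB !exprMn !sqr_sqrtr//; lra.
Qed.

Lemma sqdist_sum (J : Type) (r : seq J) (P : pred J) (f g : J -> R) :
  (forall j, 0 <= f j) -> (forall j, 0 <= g j) ->
  sqdist (\sum_(j <- r | P j) f j) (\sum_(j <- r | P j) g j) <=
  \sum_(j <- r | P j) sqdist (f j) (g j).
Proof.
move=> f0 g0; elim: r => [|j r IH]; first by rewrite !big_nil sqdistxx.
rewrite !big_cons; case: ifP => // _.
by rewrite (le_trans (sqdistD _ _ _ _)) ?sumr_ge0 ?lerD2l.
Qed.

Lemma sqdist_mean (T : finType) (f g : T -> R) :
  (forall t, 0 <= f t) -> (forall t, 0 <= g t) ->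
  sqdist (mean f) (mean g) <= mean (fun t => sqdist (f t) (g t)).
Proof.
move=> f0 g0; rewrite !meanE sqdistMr ?invr_ge0//.
by rewrite ler_wpM2r ?invr_ge0// sqdist_sum.
Qed.

Lemma sqdist_le_div p q : 0 <= p -> 0 <= q -> sqdist p q <= (p - q) ^+ 2 / (p + q).
Proof.
move=> p0 q0; have [pq0|pq0] := eqVneq (p + q) 0.
  have [-> ->] : p = 0 /\ q = 0 by split; lra.
  by rewrite sqdistxx subrr expr0n mul0r.
have s0 : 0 < p + q by rewrite lt_def pq0 addr_ge0.
rewrite ler_pdivlMr// !sqdistEsqr -{2}(sqr_sqrtr p0) -{2}(sqr_sqrtr q0).
rewrite -{3}(sqr_sqrtr p0) -{3}(sqr_sqrtr q0).
have a0 := sqrtr_ge0 p; have b0 := sqrtr_ge0 q.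
set a := Num.sqrt p in a0 *; set b := Num.sqrt q in b0 *.
rewrite subr_sqr exprMn ler_wpM2l ?sqr_ge0// sqrrD.
by have := mulr_ge0 a0 b0; rewrite -mulr_natl; lra.
Qed.

(** For the first argument of the maximum, the difference of the two sides is the square of sqrt p -
    2 sqrt q. Beyond twice [q] the excess is thus linear in the squared distance, while p - q itself
    would cost a square root. *)
Lemma excess_le p q : 0 <= p -> 0 <= q -> Num.max (p - 2 * q) 0 <= 2 * sqdist p q.
Proof.
move=> p0 q0; rewrite ge_max mulr_ge0 ?sqdist_ge0// andbT.
rewrite -{1}(sqr_sqrtr p0) -{1}(sqr_sqrtr q0) !sqdistEsqr.
have := sqr_ge0 (Num.sqrt p - 2 * Num.sqrt q).
rewrite !expr2; lra.
Qed.

(** Factor p - q as (sqrt p - sqrt q)(sqrt p + sqrt q) and apply AM-GM with a weight [lam] that is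
    chosen only at the very end. *)
Lemma absdist_le (lam p q : R) : 0 < lam -> 0 <= p -> 0 <= q ->
  p - q <= lam / 2 * sqdist p q + lam^-1 * (p + q).
Proof.
move=> l0 p0 q0.
rewrite -{1 3}(sqr_sqrtr p0) -{1 3}(sqr_sqrtr q0) !sqdistEsqr.
have a0 := sqrtr_ge0 p; have b0 := sqrtr_ge0 q.
set a := Num.sqrt p in a0 *; set b := Num.sqrt q in b0 *.
rewrite -(ler_pM2l l0) [X in _ <= X]mulrDr !mulrA divff ?gt_eqF// mul1r.
have := sqr_ge0 (lam * (a - b) - (a + b)); have := sqr_ge0 (a - b).
rewrite !expr2; lra.
Qed.

End sqdist.
(** * A level-one inequality on the cube *)

Section level_one.
Variables (R : realType) (D : finType).
Implicit Types (s : {ffun D -> bool}) (e : D) (c : D -> R).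

Definition sgn (b : bool) : R := if b then 1 else -1.

Lemma mean_bool (f : bool -> R) : mean f = (f true + f false) / 2.
Proof. by rewrite !meanE big_bool card_bool. Qed.

(** Since exp y <= 1 / (1 - y), the average is at most 1 / (1 - x^2), and this is at most 1 + 2 x^2
    in the given range. *)
Lemma cosh_le (x : R) : `|x| <= 2^-1 -> (expR x + expR (- x)) / 2 <= expR (2 * x ^+ 2).
Proof.
move=> x2; have /andP[xl xu] : - 2^-1 <= x <= 2^-1 by rewrite -ler_norml.
have ub (y : R) : `|y| <= 2^-1 -> expR y <= (1 - y)^-1.
  move=> y2; have /andP[yl yu] : - 2^-1 <= y <= 2^-1 by rewrite -ler_norml.
  rewrite -[y in expR y]opprK expRN lef_pV2 ?posrE ?expR_gt0 ?expR_ge1Dx//.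
  lra.
have h1 := ub x x2; have h2 : expR (- x) <= (1 + x)^-1.
  by have := ub (- x); rewrite normrN opprK => /(_ x2).
apply: (@le_trans _ _ (1 + 2 * x ^+ 2)); last exact: expR_ge1Dx.
apply: (@le_trans _ _ (((1 - x)^-1 + (1 + x)^-1) / 2)).
  by rewrite ler_pM2r ?invr_gt0// lerD.
have p1 : 0 < 1 - x by lra.
have p2 : 0 < 1 + x by lra.
have -> : ((1 - x)^-1 + (1 + x)^-1) / 2 = (1 - x ^+ 2)^-1.
  by field; rewrite !gt_eqF//; nra.
have q0 : 0 < 1 - x ^+ 2 by nra.
have y0 := sqr_ge0 x.
have y4 : x ^+ 2 <= 4^-1 by nra.
rewrite -[leLHS]mul1r ler_pdivrMr//; move: (x ^+ 2) y0 y4 => y y0 y4; nra.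
Qed.

Lemma rademacher_mgf c : (forall e, `|c e| <= 2^-1) ->
  mean (fun s : {ffun D -> bool} => expR (\sum_e c e * sgn (s e))) <=
  expR (2 * \sum_e c e ^+ 2).
Proof.
move=> c2.
have -> : mean (fun s : {ffun D -> bool} => expR (\sum_e c e * sgn (s e))) =
    \prod_e ((expR (c e) + expR (- c e)) / 2).
  rewrite !meanE card_ffun card_bool natrX.
  rewrite (eq_bigr _ (fun (s : {ffun D -> bool}) _ => expR_sum _ _ _)).
  rewrite -(bigA_distr_bigA (fun e b => expR (c e * sgn b))).
  rewrite big_split/= prodr_const exprVn; congr (_ * _).
  by apply: eq_bigr => e _; rewrite big_bool /= mulr1 mulrN1.
rewrite mulr_sumr expR_sum; apply: ler_prod => e _.
by rewrite divr_ge0 ?addr_ge0 ?expR_ge0//= cosh_le.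
Qed.

Section biased.
Variable phi : {ffun D -> bool} -> R.
Hypothesis phi01 : forall s, 0 <= phi s <= 1.

Let a := mean phi.
(** The mean of the sign at [e] under the density [phi / a]. *)
Let v e := mean (fun s => sgn (s e) * phi s) / a.

(** Exponential tilting: the linear form [L] has mean V / 4 under the density [phi / a], and this is
    compared with its moment generating function under the uniform law. *)
Lemma sum_sqr_bias : 0 < a -> \sum_e v e ^+ 2 <= 8 * - ln a.
Proof.
move=> a0; set V := \sum_e _.
have v1 e : `|v e| <= 1.
  rewrite normrM [`|a^-1|]ger0_norm ?invr_ge0 ?(ltW a0)// ler_pdivrMr// mul1r.
  rewrite ler_norml -mulN1r -meanZ; apply/andP; split; apply: ler_mean => s;
  by have /andP[? _] := phi01 s; rewrite /sgn; case: (s e); lra.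
(* The factor 1/4 maximizes x - 2 x^2, the gain per unit of [V]. *)
pose c e := 4^-1 * v e.
have c2 e : `|c e| <= 2^-1.
  by rewrite normrM [`|4^-1|]ger0_norm//; have := v1 e; lra.
have := rademacher_mgf c2.
have -> : \sum_e c e ^+ 2 = 16^-1 * V.
  by rewrite mulr_sumr; apply: eq_bigr => e _; rewrite exprMn; congr (_ * _); lra.
move=> mgf.
(* This shift makes the upper bound exp (V / 8 - t) equal to [a]. *)
pose t := 8^-1 * V - ln a.
pose L s := \sum_e c e * sgn (s e).
have low : a * (1 + 4^-1 * V - t) <= mean (fun s => phi s * expR (L s - t)).
  apply: (@le_trans _ _ (mean (fun s => phi s * (1 + (L s - t))))); last first.
    by apply: ler_mean => s; have /andP[? _] := phi01 s; rewrite ler_wpM2l// expR_ge1Dx.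
  have -> : mean (fun s => phi s * (1 + (L s - t))) =
      a * (1 - t) + mean (fun s => phi s * L s).
    by rewrite -meanZr -meanD; apply: eq_mean => s; ring.
  have -> : mean (fun s => phi s * L s) = a * (4^-1 * V); last by lra.
    under eq_mean do rewrite mulr_sumr.
    rewrite mean_sum !mulr_sumr; apply: eq_bigr => e _.
    have -> : mean (fun s => phi s * (c e * sgn (s e))) = c e * (v e * a).
      rewrite /v divfK ?gt_eqF// -meanZ; apply: eq_mean => s; ring.
    by rewrite /c; ring.
have upp : mean (fun s => phi s * expR (L s - t)) <= a.
  apply: (@le_trans _ _ (mean (fun s => expR (L s) * expR (- t)))).
    apply: ler_mean => s; have /andP[? p1] := phi01 s.
    by rewrite expRD ler_piMl// mulr_ge0 ?expR_ge0.
  rewrite meanZr -[leRHS](@lnK R) ?posrE//.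
  apply: (@le_trans _ _ (expR (2 * (16^-1 * V)) * expR (- t))).
    by rewrite ler_wpM2r ?expR_ge0.
  by rewrite -expRD ler_expR /t; lra.
have := le_trans low upp.
rewrite -[leRHS]mulr1 ler_pM2l// /t; lra.
Qed.

(** The two means add up to 2 a and differ by 2 a [v e], so by [sqdist_le_div] each summand is at
    most 2 a (v e)^2. *)
Lemma level_one :
  \sum_e sqdist (mean (fun s => phi (upd s e true)))
                (mean (fun s => phi (upd s e false))) <= 16 * (a * - ln a).
Proof.
have phi0 s : 0 <= phi s by have /andP[] := phi01 s.
have sumE e : mean (fun s => phi (upd s e true)) +
    mean (fun s => phi (upd s e false)) = 2 * a.
  rewrite /a (@mean_resample _ _ _ e phi) -meanD -meanZ; apply: eq_mean => s.
  by rewrite mean_bool /=; lra.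
have difE e : mean (fun s => phi (upd s e true)) -
    mean (fun s => phi (upd s e false)) = 2 * mean (fun s => sgn (s e) * phi s).
  rewrite (@mean_resample _ _ _ e (fun s => sgn (s e) * phi s)) -[in LHS]mulN1r -!meanZ -meanD.
  by apply: eq_mean => s; rewrite mean_bool !upd_same /sgn; lra.
have [a0|a0] := eqVneq a 0.
  rewrite a0 mul0r mulr0 big1// => e _.
  have := sumE e; rewrite a0 mulr0 => /eqP.
  rewrite paddr_eq0 ?mean_ge0// => /andP[/eqP-> /eqP->]; exact: sqdistxx.
have {}a0 : 0 < a by rewrite lt_def a0 mean_ge0.
apply: (@le_trans _ _ (\sum_e (2 * a) * v e ^+ 2)).
  apply: ler_sum => e _.
  rewrite (le_trans (sqdist_le_div _ _)) ?mean_ge0// sumE difE /v.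
  by rewrite le_eqVlt; apply/orP; left; apply/eqP; field; rewrite gt_eqF.
rewrite -mulr_sumr; have := sum_sqr_bias a0.
set V := \sum_e _ => h; have : a * V <= a * (8 * - ln a) by rewrite ler_pM2l.
lra.
Qed.

End biased.
End level_one.

(** Follows termwise from 1 - ln y <= 1 / y at y = [p h * #|H|]. The additive 1 makes room for
    weights of total less than 1. *)
Lemma entropy_le (R : realType) (H : finType) (p : H -> R) :
  (forall h, 0 <= p h) -> \sum_h p h <= 1 ->
  \sum_h p h * - ln (p h) <= ln #|H|%:R + 1.
Proof.
move=> p0 p1.
have [H0|H0] := posnP #|H|.
  rewrite big1 => [|h _]; first by rewrite H0 ln0 ?add0r.
  by move: (max_card (pred1 h)); rewrite card1 H0.
have N0 : 0 < #|H|%:R :> R by rewrite ltr0n.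
have lnN : 0 <= ln (#|H|%:R : R) by rewrite ln_ge0// ler1n.
have pt h : p h * - ln (p h) <= p h * ln #|H|%:R + #|H|%:R^-1.
  have [->|ph] := eqVneq (p h) 0; first by rewrite !mul0r add0r invr_ge0.
  have {}ph : 0 < p h by rewrite lt_def ph p0.
  have := expR_ge1Dx (- ln (p h * #|H|%:R)).
  rewrite expRN lnK ?posrE ?mulr_gt0// lnM ?posrE// => e.
  have := ler_wpM2l (ltW ph) e.
  rewrite invfM mulrA divff ?gt_eqF// mul1r; lra.
apply: (le_trans (ler_sum _ (fun h _ => pt h))).
rewrite big_split/= -mulr_suml sumr_const -[_^-1 *+ _]mulr_natr mulVf ?gt_eqF// lerD2r.
by rewrite ler_piMl.
Qed.
(** * Hardness of finding a planted intersection *)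

Section cut_and_paste.
Variables (R : realType) (H : finType) (a b : bool -> H -> R).
Hypothesis a0 : forall c h, 0 <= a c h.
Hypothesis b0 : forall c h, 0 <= b c h.
Let p c c' h := a c h * b c' h.

(* p 1 1 * p 0 0 = p 1 0 * p 0 1. Only p 1 0 and p 0 1 need to be distributions:
   the doubly planted input (1, 1) violates the promise. *)
Lemma cut_and_paste :
  \sum_h p false false h <= 1 -> \sum_h p true true h <= 1 ->
  \sum_h p true false h = 1 -> \sum_h p false true h = 1 ->
  \sum_h sqdist (p false false h) (p true true h) <=
  \sum_h sqdist (p true false h) (p false true h).
Proof.
have p0 c c' h : 0 <= p c c' h by exact: mulr_ge0.
have sumE c1 c2 c3 c4 : \sum_h sqdist (p c1 c2 h) (p c3 c4 h) =
    \sum_h p c1 c2 h + \sum_h p c3 c4 h - \sum_h 2 * Num.sqrt (p c1 c2 h * p c3 c4 h).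
  by rewrite -big_split -sumrB; apply: eq_bigr => h _; rewrite sqdistE.
move=> h00 h11 h10 h01; rewrite !sumE.
have -> : \sum_h 2 * Num.sqrt (p false false h * p true true h) =
          \sum_h 2 * Num.sqrt (p true false h * p false true h).
  by apply: eq_bigr => h _; congr (2 * Num.sqrt _); rewrite /p; ring.
lra.
Qed.

(** The first mixture is that of a random coordinate: its bit is set with probability 1/4 at the
    first player, 1/4 at the second one, and 1/2 at neither. It is compared with the input where the
    bit is set at neither. *)
Lemma sqdist_mixture h :
  sqdist (4^-1 * p true false h + (2^-1 * p false false h + 4^-1 * p false true h))
         (4^-1 * p false false h + (2^-1 * p false false h + 4^-1 * p false false h)) <=
  4^-1 * (b false h * sqdist (a true h) (a false h) +
          a false h * sqdist (b true h) (b false h)).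
Proof.
have p0 c c' : 0 <= p c c' h by exact: mulr_ge0.
have q4 c c' : 0 <= 4^-1 * p c c' h by rewrite mulr_ge0.
have q2 c c' : 0 <= 2^-1 * p c c' h by rewrite mulr_ge0.
apply: le_trans (sqdistD _ _ _ _) _ => //; [exact: addr_ge0..|].
rewrite mulrDr lerD//.
  by rewrite sqdistMl// sqdistMr// [_ * b false h]mulrC.
apply: le_trans (sqdistD _ _ _ _) _ => //.
by rewrite sqdistxx add0r sqdistMl// sqdistMl.
Qed.

Lemma sqdist_both h :
  sqdist (p true false h) (p false true h) <=
  2 * (b false h * sqdist (a true h) (a false h) +
       a false h * sqdist (b true h) (b false h)).
Proof.
apply: le_trans (sqdist_tri (p false false h) _ _) _.
by rewrite sqdistMr// sqdistMl// [sqdist (b false h) _]sqdistC mulrDr [_ * b false h]mulrC.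
Qed.

End cut_and_paste.

(** * Random inputs with planted pointers *)

Section planted.
Variables (R : realType) (m : nat).
Local Notation coord := ('I_m * 'I_m)%type.
Local Notation cube := {ffun 'I_m * 'I_m -> bool}.
Local Notation pmap := {ffun 'I_m -> 'I_m}.
Implicit Types (F : pmap) (w s : cube) (e : coord) (X S T : Defs.family m -> bool).

(* The coordinate (x, i) belongs to the first player if w (x, i), and to the
   second one otherwise; only its owner may put i into its set at x, except that
   F x is put into both sets. *)
Definition planted F w s : Defs.family m :=
  [ffun x => [set i | (s (x, i) && w (x, i)) || (i == F x)]%SET].

Definition negf w : cube := [ffun e => ~~ w e].

Definition prob X F w : R := mean (fun s => (X (planted F w s))%:R).

(** The probability that a random input with pointers [F] lies in the rectangle S x T. Given the
    owners the two inputs are independent, hence the product. *)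
Definition nu S T F : R := mean (fun w => prob S F w * prob T F (negf w)).

(** The player is first made the owner of [e], since otherwise the bit at [e] would have no
    effect. *)
Definition forced X F e c w : R :=
  mean (fun s => (X (planted F (upd w e true) (upd s e c)))%:R).

Lemma planted_inter F w s s' x :
  planted F w s x :&: planted F (negf w) s' x = [set F x]%SET.
Proof.
apply/setP => i; rewrite !inE !ffunE !inE !ffunE.
by case: (i == F x); rewrite ?orbT// !orbF; case: (w _); rewrite !(andbF, andbT).
Qed.

Lemma negfK : involutive negf.
Proof. by move=> w; apply/ffunP => e; rewrite !ffunE negbK. Qed.

Lemma negf_upd w e b : negf (upd w e b) = upd (negf w) e (~~ b).
Proof. by apply/ffunP => e'; rewrite !ffunE; case: eqP. Qed.

Lemma mean_negf (f : cube -> R) : mean f = mean (f \o negf).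
Proof. by apply: mean_bij; exists negf; exact: negfK. Qed.

Lemma prob_ge0 X F w : 0 <= prob X F w.
Proof. exact: mean_ge0. Qed.

Lemma forced_ge0 X F e c w : 0 <= forced X F e c w.
Proof. exact: mean_ge0. Qed.

Lemma nu_ge0 S T F : 0 <= nu S T F.
Proof. by apply: mean_ge0 => w; rewrite mulr_ge0 ?prob_ge0. Qed.

Lemma planted_unowned F w s e :
  planted F (upd w e false) s = planted F (upd w e true) (upd s e false).
Proof.
apply/ffunP => x; rewrite !ffunE; apply/setP => i; rewrite !inE !ffunE.
by case: eqP => //; rewrite andbF.
Qed.

Lemma prob_unowned X F e w : prob X F (upd w e false) = forced X F e false w.
Proof. by apply: eq_mean => s; rewrite planted_unowned. Qed.

Lemma prob_owned X F e w :
  prob X F (upd w e true) = (forced X F e true w + forced X F e false w) / 2.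
Proof.
rewrite /prob (@mean_resample _ _ _ e) -meanD -meanZr; apply: eq_mean => s.
exact: mean_bool.
Qed.

Lemma forced_upd X F e c w b : forced X F e c (upd w e b) = forced X F e c w.
Proof. by apply: eq_mean => s; rewrite upd_upd. Qed.

Lemma forced_owned X F e c w : w e ->
  forced X F e c w = mean (fun s => (X (planted F w (upd s e c)))%:R).
Proof.
move=> we; apply: eq_mean => s.
by have -> : upd w e true = w by rewrite -{2}(upd_id w e) we.
Qed.

(* Planting k at x on top of F, and F x on top of F[x -> k], give the same
   inputs. *)
Lemma forced_twice X F x k w :
  forced X F (x, k) true w = forced X (upd F x k) (x, F x) true w.
Proof.
rewrite /forced.
(* Each side resamples the bit that is immaterial to it, its element being planted anyway. Both
   sides then average over the same variables. *)
rewrite (@mean_resample _ _ _ (x, F x)) [RHS](@mean_resample _ _ _ (x, k)).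
apply: eq_mean => s; apply: eq_mean => b; congr (X _)%:R.
apply/ffunP => y; rewrite !ffunE; apply/setP => i; rewrite !inE !ffunE !xpair_eqE.
have [->|yx] := eqVneq y x; rewrite ?eqxx ?(negbTE yx)//=.
have [->|iF] := eqVneq i (F x); rewrite ?eqxx ?orbT ?andbT//=.
have [->|ik] := eqVneq i k; rewrite ?eqxx ?orbT ?andbT//=.
Qed.

(** * Influence of single coordinates on the leaf distribution *)

Section rectangles.
Variables (H : finType) (S T : H -> Defs.family m -> bool).
(** On all inputs the rectangles are disjoint, but covering is assumed only for planted inputs: an
    input with two common elements at some x breaks the promise and may reach no leaf. *)
Hypothesis disjoint_rect : forall a b, \sum_h (S h a)%:R * (T h b)%:R <= 1 :> R.
Hypothesis cover_planted : forall F w s s',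
  \sum_h (S h (planted F w s))%:R * (T h (planted F (negf w) s'))%:R = 1 :> R.

Lemma sum_mean_rect_le1 (J J' : finType) (p : J -> Defs.family m) (q : J' -> Defs.family m) :
  \sum_h mean (fun j => (S h (p j))%:R) * mean (fun j => (T h (q j))%:R) <= 1 :> R.
Proof.
under eq_bigr do rewrite -mean_prod.
rewrite -mean_sum; apply: mean_le_const => // j.
by rewrite -mean_sum; apply: mean_le_const => // j'; exact: disjoint_rect.
Qed.

Lemma sum_mean_rect_eq1 (p q : cube -> Defs.family m) :
  (forall s s', \sum_h (S h (p s))%:R * (T h (q s'))%:R = 1 :> R) ->
  \sum_h mean (fun s => (S h (p s))%:R) * mean (fun s => (T h (q s))%:R) = 1 :> R.
Proof.
move=> pq; under eq_bigr do rewrite -mean_prod.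
have c0 : (0 < #|cube|)%N by apply/card_gt0P; exists [ffun=> false].
rewrite -mean_sum -[RHS](@mean_const R cube 1 c0); apply: eq_mean => s.
by rewrite -mean_sum -[RHS](@mean_const R cube 1 c0); apply: eq_mean => s'.
Qed.

(* The squared Hellinger distance between the leaf distributions for the two
   values of the bit at e, added up over the two possible owners of e. *)
Definition influence F e : R := mean (fun w => \sum_h
  (forced (T h) F e false (negf w) *
     sqdist (forced (S h) F e true w) (forced (S h) F e false w) +
   forced (S h) F e false w *
     sqdist (forced (T h) F e true (negf w)) (forced (T h) F e false (negf w)))).

Lemma influence_ge0 F e : 0 <= influence F e.
Proof.
apply: mean_ge0 => w; apply: sumr_ge0 => h _.
by apply: addr_ge0; apply: mulr_ge0; rewrite ?forced_ge0 ?sqdist_ge0.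
Qed.

(** The player owns [e] with probability 1/2, which gives a factor 2; for fixed owners, the sum over
    [e] is bounded by [level_one]. *)
Lemma one_sided_influence (X Y : Defs.family m -> bool) F :
  \sum_e mean (fun w => forced Y F e false (negf w) *
     sqdist (forced X F e true w) (forced X F e false w)) <=
  32 * mean (fun w => prob Y F (negf w) * (prob X F w * - ln (prob X F w))).
Proof.
pose d w e := sqdist (mean (fun s => (X (planted F w (upd s e true)))%:R : R))
                     (mean (fun s => (X (planted F w (upd s e false)))%:R)).
have owned e : mean (fun w => forced Y F e false (negf w) *
     sqdist (forced X F e true w) (forced X F e false w)) =
  2 * mean (fun w => prob Y F (negf w) * d w e).
  rewrite (@mean_resample _ _ _ e) [in RHS](@mean_resample _ _ _ e) -meanZ.
  apply: eq_mean => w; rewrite !mean_bool !negf_upd/= !forced_upd.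
  rewrite prob_unowned.
  have -> : d (upd w e true) e = sqdist (forced X F e true w) (forced X F e false w).
    have we : upd w e true e by rewrite upd_same.
    by rewrite /d -(forced_owned X F true we) -(forced_owned X F false we) !forced_upd.
  (* The bit at a coordinate that is not owned is ignored. *)
  have -> : d (upd w e false) e = 0.
    rewrite -[RHS](sqdistxx (mean (fun s => (X (planted F (upd w e false) s))%:R))).
    by congr sqdist; apply: eq_mean => s; rewrite !planted_unowned upd_upd.
  by field.
under eq_bigr do rewrite owned.
rewrite -mulr_sumr -mean_sum (_ : 32 = 2 * 16 :> R); last by ring.
rewrite -mulrA ler_wpM2l// -meanZ; apply: ler_mean => w.
rewrite -mulr_sumr mulrCA ler_wpM2l ?prob_ge0//.
by apply: level_one => s; case: (X _); rewrite ?ler01 ?lexx.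
Qed.

(** The two one-sided bounds add up to the entropy of the leaf distribution, because - ln (a b) = -
    ln a - ln b. *)
Lemma sum_influence F : \sum_e influence F e <= 32 * (ln #|H|%:R + 1).
Proof.
pose a h w := prob (S h) F w; pose b h w := prob (T h) F (negf w).
apply: (@le_trans _ _ (\sum_h 32 * mean (fun w =>
   b h w * (a h w * - ln (a h w)) + a h w * (b h w * - ln (b h w))))).
  rewrite /influence; under eq_bigr do rewrite mean_sum.
  rewrite exchange_big; apply: ler_sum => h _.
  under eq_bigr do rewrite meanD.
  rewrite big_split/= meanD mulrDr lerD ?one_sided_influence//.
  (* Complementing the owners exchanges the two players. *)
  have flip e : mean (fun w => forced (S h) F e false w *
      sqdist (forced (T h) F e true (negf w)) (forced (T h) F e false (negf w))) =
    mean (fun w => forced (S h) F e false (negf w) *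
      sqdist (forced (T h) F e true w) (forced (T h) F e false w)).
    by rewrite mean_negf; apply: eq_mean => w /=; rewrite negfK.
  rewrite (eq_bigr _ (fun e _ => flip e)).
  rewrite (_ : mean (fun w => a h w * _) = mean (fun w => prob (S h) F (negf w) *
    (prob (T h) F w * - ln (prob (T h) F w)))); first exact: one_sided_influence.
  by rewrite mean_negf; apply: eq_mean => w; rewrite /= /a /b negfK.
rewrite -mulr_sumr ler_wpM2l// -mean_sum; apply: mean_le_const.
  have [H0|H0] := posnP #|H|; first by rewrite H0 ln0 ?add0r.
  by rewrite addr_ge0// ln_ge0// ler1n.
move=> w; apply: le_trans (@entropy_le R H (fun h => a h w * b h w) _ _).
- apply: ler_sum => h _.
  have [->|a0] := eqVneq (a h w) 0; first by rewrite !(mul0r, mulr0) addr0.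
  have [->|b0] := eqVneq (b h w) 0; first by rewrite !(mul0r, mulr0) addr0.
  rewrite lnM ?posrE ?lt_def ?a0 ?b0 ?prob_ge0//.
  by rewrite le_eqVlt; apply/orP; left; apply/eqP; ring.
- by move=> h; rewrite mulr_ge0 ?prob_ge0.
- exact: sum_mean_rect_le1.
Qed.

(** Cut and paste. An input with [e] in exactly one of the two sets is a planted one, so its leaf
    weights add up to 1; for the other two inputs disjointness suffices. *)
Lemma sum_forced_sqdist F e w :
  \sum_h sqdist (forced (S h) F e false w * forced (T h) F e false (negf w))
                (forced (S h) F e true w * forced (T h) F e true (negf w)) <=
  \sum_h sqdist (forced (S h) F e true w * forced (T h) F e false (negf w))
                (forced (S h) F e false w * forced (T h) F e true (negf w)).
Proof.
apply: (@cut_and_paste R H (fun c h => forced (S h) F e c w)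
                           (fun c h => forced (T h) F e c (negf w))).
- by move=> c h; exact: forced_ge0.
- by move=> c h; exact: forced_ge0.
- exact: sum_mean_rect_le1.
- exact: sum_mean_rect_le1.
- apply: sum_mean_rect_eq1 => s s'.
  have -> : planted F (upd (negf w) e true) (upd s' e false) =
            planted F (negf (upd w e true)) s'.
    by rewrite negf_upd planted_unowned.
  exact: cover_planted.
- apply: sum_mean_rect_eq1 => s s'.
  rewrite -planted_unowned (_ : upd (negf w) e true = negf (upd w e false)).
    exact: cover_planted.
  by rewrite negf_upd.
Qed.

Definition twice F e h : R :=
  mean (fun w => forced (S h) F e true w * forced (T h) F e true (negf w)).

(** The comparison passes through the input with [e] at neither player, at distances of 1/4 and 2
    influences; 9/2 = 2 (1/4 + 2). *)
Lemma sum_sqdist_twice F e :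
  \sum_h sqdist (nu (S h) (T h) F) (twice F e h) <= 9 / 2 * influence F e.
Proof.
pose a c h w := forced (S h) F e c w.
pose b c h w := forced (T h) F e c (negf w).
have a0 c h w : 0 <= a c h w by exact: forced_ge0.
have b0 c h w : 0 <= b c h w by exact: forced_ge0.
pose none h := mean (fun w => a false h w * b false h w).
have nuE h : nu (S h) (T h) F = mean (fun w =>
    4^-1 * (a true h w * b false h w) +
    (2^-1 * (a false h w * b false h w) + 4^-1 * (a false h w * b true h w))).
  rewrite /nu (@mean_resample _ _ _ e); apply: eq_mean => w.
  rewrite mean_bool !negf_upd !prob_owned !prob_unowned.
  rewrite -/(a true h w) -/(a false h w) -/(b true h w) -/(b false h w).
  by move: (a _ _ _) (a _ _ _) (b _ _ _) (b _ _ _) => x y z t; field.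
pose inf w h := b false h w * sqdist (a true h w) (a false h w) +
                a false h w * sqdist (b true h w) (b false h w).
have infE : influence F e = mean (fun w => \sum_h inf w h) by [].
have d1 : \sum_h sqdist (nu (S h) (T h) F) (none h) <= 4^-1 * influence F e.
  rewrite infE mean_sum mulr_sumr; apply: ler_sum => h _; rewrite nuE.
  have -> : none h = mean (fun w => 4^-1 * (a false h w * b false h w) +
    (2^-1 * (a false h w * b false h w) + 4^-1 * (a false h w * b false h w))).
    by apply: eq_mean => w; move: (_ * _) => x; field.
  rewrite -meanZ; apply: le_trans (sqdist_mean _ _) _.
  - by move=> w; rewrite !addr_ge0// !mulr_ge0.
  - by move=> w; rewrite !addr_ge0// !mulr_ge0.
  apply: ler_mean => w.
  exact: (@sqdist_mixture R H (fun c h => a c h w) (fun c h => b c h w)).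
have d2 : \sum_h sqdist (none h) (twice F e h) <= 2 * influence F e.
  apply: (@le_trans _ _ (mean (fun w => \sum_h
      sqdist (a false h w * b false h w) (a true h w * b true h w)))).
    rewrite mean_sum; apply: ler_sum => h _.
    by apply: sqdist_mean => w; rewrite mulr_ge0 ?forced_ge0.
  rewrite infE -meanZ; apply: ler_mean => w; apply: le_trans (sum_forced_sqdist F e w) _.
  rewrite mulr_sumr; apply: ler_sum => h _.
  exact: (@sqdist_both R H (fun c h => a c h w) (fun c h => b c h w)).
apply: (@le_trans _ _ (\sum_h (2 * sqdist (nu (S h) (T h) F) (none h) +
                                2 * sqdist (none h) (twice F e h)))).
  by apply: ler_sum => h _; exact: sqdist_tri.
rewrite big_split/= -!mulr_sumr; move: d1 d2.
move: (\sum_h sqdist (nu _ _ _) _) (\sum_h sqdist (none h) _) (influence _ _) => x y z.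
lra.
Qed.

(** Both pointer functions are compared with the same doubly planted input, by [forced_twice]. *)
Lemma sum_sqdist_upd F x k :
  \sum_h sqdist (nu (S h) (T h) F) (nu (S h) (T h) (upd F x k)) <=
  9 * (influence F (x, k) + influence (upd F x k) (x, F x)).
Proof.
have twiceC h : twice F (x, k) h = twice (upd F x k) (x, F x) h.
  by apply: eq_mean => w; rewrite [in LHS](forced_twice (S h)) [in LHS](forced_twice (T h)).
apply: (@le_trans _ _ (\sum_h (2 * sqdist (nu (S h) (T h) F) (twice F (x, k) h) +
   2 * sqdist (nu (S h) (T h) (upd F x k)) (twice (upd F x k) (x, F x) h)))).
  apply: ler_sum => h _; rewrite [X in _ + 2 * X]sqdistC -twiceC; exact: sqdist_tri.
rewrite big_split/= -!mulr_sumr.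
move: (sum_sqdist_twice F (x, k)) (sum_sqdist_twice (upd F x k) (x, F x)).
move: (\sum_h _) (\sum_h _) (influence _ _) (influence _ _) => y z t u.
lra.
Qed.

End rectangles.

(* The rectangles may depend on a function z of the planted pointers because they
   are refined below by the most revealing final answers, which depend on the
   path. *)
Lemma planted_pointer_hidden (Z : eqType) (z : pmap -> Z) (H : finType)
    (S T : Z -> H -> Defs.family m -> bool) :
  (forall c a b, \sum_h (S c h a)%:R * (T c h b)%:R <= 1 :> R) ->
  (forall c F w s s', \sum_h (S c h (planted F w s))%:R *
     (T c h (planted F (negf w) s'))%:R = 1 :> R) ->
  mean (fun F => \sum_x \sum_k (z (upd F x k) == z F)%:R *
    \sum_h sqdist (nu (S (z F) h) (T (z F) h) F)
                  (nu (S (z F) h) (T (z F) h) (upd F x k))) <=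
  576 * (ln #|H|%:R + 1).
Proof.
move=> disj cover; pose inf F e := influence (S (z F)) (T (z F)) F e.
have inf0 F e : 0 <= inf F e by exact: influence_ge0.
have half : mean (fun F => \sum_x \sum_k inf F (x, k)) <= 32 * (ln #|H|%:R + 1).
  apply: mean_le_const.
    have [H0|H0] := posnP #|H|; first by rewrite H0 ln0 ?add0r.
    by rewrite mulr_ge0// addr_ge0// ln_ge0// ler1n.
  by move=> F; rewrite pair_bigA /=; under eq_bigr do rewrite -surjective_pairing;
     apply: sum_influence.
apply: (@le_trans _ _ (mean (fun F => 9 * (\sum_x \sum_k inf F (x, k)) +
    9 * (\sum_x \sum_k inf (upd F x k) (x, F x))))).
  apply: ler_mean => F; rewrite !mulr_sumr -big_split; apply: ler_sum => x _.
  rewrite !mulr_sumr -big_split; apply: ler_sum => k _ /=.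
  (* If [z] is unchanged, both influences refer to the same rectangles; otherwise the left side
     vanishes. *)
  case: eqP => [zz|_]; last by rewrite mul0r addr_ge0 ?mulr_ge0.
  rewrite mul1r -mulrDr {2}/inf zz.
  exact: (sum_sqdist_upd (disj _) (cover _)).
rewrite meanD !meanZ -mulrDr.
(* Exchanging [k] with [F x] identifies the two averages, and 576 = 2 * 9 * 32. *)
have -> : mean (fun F => \sum_x \sum_k inf (upd F x k) (x, F x)) =
  mean (fun F => \sum_x \sum_k inf F (x, k)).
  rewrite !mean_sum; apply: eq_bigr => x _.
  by rewrite [RHS](@mean_upd_swap _ _ _ x).
by move: half; move: (mean _) (ln _) => y t; lra.
Qed.

End planted.
(** * Pointer chasing with rectangles *)

Section paths.
Variables (m : nat) (z0 : 'I_m).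
Local Notation pmap := {ffun 'I_m -> 'I_m}.
Implicit Types (F G : pmap) (b : bool) (p : seq 'I_m).

(* Paths are stored newest pointer first, and side [false] is the pair P_A, P_B,
   side [true] the pair P_C, P_D. *)
Fixpoint paths (j : nat) : seq (seq 'I_m) :=
  if j is l.+1 then [seq i :: p | p <- paths l, i <- index_enum 'I_m]
  else [:: [:: z0]].

(** Only the steps made by side [b] are tested, so that walking along [p] splits into one event for
    each side. *)
Fixpoint follows b F p : bool :=
  if p is i :: (y :: _) as p'
  then ((odd (size p').-1 == b) ==> (F y == i)) && follows b F p' else true.

(** Here [F] is the function of side [b] and [G] that of the other side. *)
Fixpoint walk (j : nat) b F G : seq 'I_m :=
  if j is l.+1 then
    (if odd l == b then F else G) (head z0 (walk l b F G)) :: walk l b F G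
  else [:: z0].

Lemma size_paths j p : p \in paths j -> size p = j.+1.
Proof.
elim: j p => [p|j IH p]; first by rewrite inE => /eqP->.
by case/allpairsP => -[q i] [/= /IH sq _ ->] /=; rewrite sq.
Qed.

Lemma size_walk j b F G : size (walk j b F G) = j.+1.
Proof. by elim: j => //= j ->. Qed.

Lemma big_paths_cons (V : nmodType) j (g : seq 'I_m -> V) :
  \sum_(p <- paths j.+1) g p = \sum_(p <- paths j) \sum_i g (i :: p).
Proof. by rewrite /= big_allpairs_dep. Qed.

Lemma follows_cons b F i p : (0 < size p)%N ->
  follows b F (i :: p) =
  ((odd (size p).-1 == b) ==> (F (head z0 p) == i)) && follows b F p.
Proof. by case: p. Qed.

Lemma follows_upd b F x k p : x \notin p -> follows b (upd F x k) p = follows b F p.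
Proof.
elim: p => // i [|y p] IH //; rewrite inE negb_or => /andP[_ xp].
rewrite follows_cons// [RHS]follows_cons// IH//= ffunE.
by move: xp; rewrite inE negb_or eq_sym => /andP[/negbTE->].
Qed.

Lemma walk_upd j b F G x k : x \notin walk j b F G ->
  walk j b (upd F x k) G = walk j b F G.
Proof.
elim: j => //= j IH; rewrite inE negb_or => /andP[_ xw]; rewrite IH//.
case: ifP => // _; rewrite ffunE; case: eqP => // xE; move: xw; rewrite -xE.
by case: (walk j b F G) (size_walk j b F G) => //= y w _; rewrite mem_head.
Qed.

(** The path walked by [F] and [G] is the only one to pass the tests of both sides. Read from right
    to left, this decouples the two sides. *)
Lemma sum_paths (R : realType) j b F G (g : seq 'I_m -> R) :
  \sum_(p <- paths j) (follows b F p)%:R * (follows (~~ b) G p)%:R * g p =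
  g (walk j b F G).
Proof.
elim: j g => [|j IH] g; first by rewrite /= big_seq1 /= !mul1r.
rewrite big_paths_cons.
rewrite -[RHS]/((fun p => g ((if odd j == b then F else G) (head z0 p) :: p))
                (walk j b F G)) -IH.
apply: eq_big_seq => p /size_paths sp.
pose y := (if odd j == b then F else G) (head z0 p).
have side (c d : bool) : (c == ~~ d) = ~~ (c == d) by case: c d => -[].
rewrite (bigD1 y)// big1 => [|i iy].
  rewrite !follows_cons ?sp//= addr0 side.
  by rewrite /y; case: (odd j == b); rewrite /= ?eqxx ?andbT.
rewrite !follows_cons ?sp//= side; move: iy; rewrite eq_sym /y.
by case: (odd j == b) => /= /negbTE->; rewrite /= !(mul0r, mulr0).
Qed.

End paths.

(** * Masses of leaves and distance of a pointer from uniform *)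

Section masses.
Variables (R : realType) (m : nat) (z0 : 'I_m).
Local Notation pmap := {ffun 'I_m -> 'I_m}.
Local Notation pr := (Defs.family m -> bool).
Implicit Types (F G : pmap) (b o : bool) (p : seq 'I_m) (S T : pr).

(* A leaf consists of one rectangle for each side, and the probability of reaching
   it with path p is the product of the masses of the two rectangles. *)
Definition mass b p S T : R := mean (fun F => (follows b F p)%:R * nu R S T F).

Definition mass_at b p x k S T : R :=
  mean (fun F => (F x == k)%:R * ((follows b F p)%:R * nu R S T F)).

(** The squared Hellinger distance between the conditional law of the pointer at [x] and the uniform
    law, scaled by the mass. *)
Definition disc b p x S T : R :=
  \sum_k sqdist (mass_at b p x k S T) (mass b p S T / m%:R).

Lemma eq_nu S T S' T' F : S =1 S' -> T =1 T' -> nu R S T F = nu R S' T' F.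
Proof.
move=> SS TT; apply: eq_mean => w; congr (_ * _); apply: eq_mean => s.
  by rewrite SS.
by rewrite TT.
Qed.

Lemma eq_mass b p S T S' T' : S =1 S' -> T =1 T' -> mass b p S T = mass b p S' T'.
Proof. by move=> SS TT; apply: eq_mean => F; rewrite (eq_nu _ SS TT). Qed.

Lemma eq_mass_at b p x k S T S' T' : S =1 S' -> T =1 T' ->
  mass_at b p x k S T = mass_at b p x k S' T'.
Proof. by move=> SS TT; apply: eq_mean => F; rewrite (eq_nu _ SS TT). Qed.

Lemma eq_disc b p x S T S' T' : S =1 S' -> T =1 T' ->
  disc b p x S T = disc b p x S' T'.
Proof.
move=> SS TT; apply: eq_bigr => k _.
by rewrite (eq_mass_at _ _ _ _ SS TT) (eq_mass _ _ SS TT).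
Qed.

Lemma mass_ge0 b p S T : 0 <= mass b p S T.
Proof. by apply: mean_ge0 => F; rewrite mulr_ge0 ?nu_ge0. Qed.

Lemma mass_at_ge0 b p x k S T : 0 <= mass_at b p x k S T.
Proof. by apply: mean_ge0 => F; rewrite !mulr_ge0 ?nu_ge0. Qed.

Lemma disc_ge0 b p x S T : 0 <= disc b p x S T.
Proof. by apply: sumr_ge0 => k _; exact: sqdist_ge0. Qed.

Lemma sum_mass_at b p x S T : \sum_k mass_at b p x k S T = mass b p S T.
Proof.
rewrite -mean_sum; apply: eq_mean => F; rewrite -mulr_suml (bigD1 (F x))//=.
by rewrite eqxx big1 ?addr0 ?mul1r// => k /negbTE; rewrite eq_sym => ->.
Qed.

Let m_gt0 : (0 < m)%N. Proof. by case: m z0 => // -[]. Qed.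

Lemma sum_mass_div b p S T : \sum_(k < m) mass b p S T / m%:R = mass b p S T.
Proof.
by rewrite sumr_const card_ord -[_ *+ m]mulr_natr divfK// pnatr_eq0 -lt0n.
Qed.

Lemma disc_le b p x S T : disc b p x S T <= 2 * mass b p S T.
Proof.
apply: (@le_trans _ _ (\sum_k (mass_at b p x k S T + mass b p S T / m%:R))).
  by apply: ler_sum => k _; rewrite sqdist_le ?mass_at_ge0 ?divr_ge0 ?mass_ge0.
by rewrite big_split/= sum_mass_at sum_mass_div mulr_natl mulr2n.
Qed.

(** As the path does not test the value at [x], the mass at k is 1/m times the mass with k planted
    at [x]; then the distance is convex. *)
Lemma disc_hidden b p x S T :
  (forall F k, follows b (upd F x k) p = follows b F p) ->
  disc b p x S T <= m%:R^-1 * mean (fun F => (follows b F p)%:R *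
     \sum_k sqdist (nu R S T F) (nu R S T (upd F x k))).
Proof.
move=> insens.
have -> : mean (fun F => (follows b F p)%:R *
     \sum_k sqdist (nu R S T F) (nu R S T (upd F x k))) =
  \sum_k mean (fun F => (follows b F p)%:R *
     sqdist (nu R S T F) (nu R S T (upd F x k))).
  by rewrite -mean_sum; apply: eq_mean => F; rewrite mulr_sumr.
rewrite mulr_sumr; apply: ler_sum => k _.
rewrite /mass_at mean_preim card_ord sqdistC [_ / m%:R]mulrC sqdistMl ?invr_ge0//.
rewrite ler_wpM2l ?invr_ge0//.
apply: le_trans (sqdist_mean _ _) _ => [F|F|]; rewrite ?mulr_ge0 ?nu_ge0//.
by apply: ler_mean => F; rewrite insens sqdistMl.
Qed.

Lemma nu_andl (c : bool) S T F : nu R (fun a => c && S a) T F = c%:R * nu R S T F.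
Proof.
case: c; first by rewrite mul1r; apply: eq_nu.
rewrite mul0r; apply: mean0 => w.
by rewrite (_ : prob R _ F w = 0) ?mul0r//; apply: mean0.
Qed.

End masses.

(** * Sums over families of leaves, and leaves refined by a final answer *)

Section nu_sums.
Variables (R : realType) (m : nat).
Local Notation pmap := {ffun 'I_m -> 'I_m}.
Local Notation fam := {ffun 'I_m -> {set 'I_m}}.
Implicit Types (F : pmap) (S T : Defs.family m -> bool).

Lemma nu_meanE S T F : nu R S T F = mean (fun w => mean (fun s => mean (fun s' =>
  (S (planted F w s))%:R * (T (planted F (negf w) s'))%:R))).
Proof. by apply: eq_mean => w; rewrite mean_prod. Qed.

Lemma nu_const (c : bool) F : nu R (fun=> c) (fun=> c) F = c%:R.
Proof.
have c0 : (0 < #|{ffun 'I_m * 'I_m -> bool}|)%N by apply/card_gt0P; exists [ffun=> false].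
rewrite nu_meanE -[RHS](mean_const _ c0); apply: eq_mean => w.
rewrite -[RHS](mean_const _ c0); apply: eq_mean => s.
by rewrite -[RHS](mean_const _ c0); apply: eq_mean => s'; rewrite -natrM mulnb andbb.
Qed.

Lemma nu_sum (V : finType) (P : pred V) (Sv Tv : V -> Defs.family m -> bool) S T F :
  (forall a b, (S a)%:R * (T b)%:R = \sum_(v | P v) (Sv v a)%:R * (Tv v b)%:R :> R) ->
  nu R S T F = \sum_(v | P v) nu R (Sv v) (Tv v) F.
Proof.
move=> STE; rewrite -mean_sum nu_meanE; apply: eq_mean => w.
under [RHS]eq_bigr do rewrite -mean_prod.
rewrite -mean_sum; apply: eq_mean => s.
by rewrite -mean_sum; apply: eq_mean => s'.
Qed.

(** The weights [c] stand for the factors of the other pair, so that two applications treat both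
    pairs. *)
Lemma nu_sum_le1 (H : finType) (Sv Tv : H -> Defs.family m -> bool) (c : H -> R) F :
  (forall a b, \sum_h (Sv h a)%:R * (Tv h b)%:R * c h <= 1) ->
  \sum_h nu R (Sv h) (Tv h) F * c h <= 1.
Proof.
move=> le1; under eq_bigr do rewrite -meanZr.
rewrite -mean_sum; apply: mean_le_const => // w.
under eq_bigr do rewrite -mean_prod -meanZr.
rewrite -mean_sum; apply: mean_le_const => // s.
under eq_bigr do rewrite -meanZr.
by rewrite -mean_sum; apply: mean_le_const => // s'.
Qed.

(* The leaf S x T restricted to the inputs for which the first player (if q.1)
   or the second player applies the function q.2 and obtains the answer o. *)
Definition extS (q : bool * {ffun fam -> bool}) (o : bool) S : Defs.family m -> bool :=
  fun a => S a && (q.1 ==> (q.2 a == o)).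
Definition extT (q : bool * {ffun fam -> bool}) (o : bool) T : Defs.family m -> bool :=
  fun a => T a && (~~ q.1 ==> (q.2 a == o)).

Lemma sum_nu_ext q S T F : \sum_o nu R (extS q o S) (extT q o T) F = nu R S T F.
Proof.
apply/esym/(@nu_sum _ predT (fun o => extS q o S) (fun o => extT q o T)) => a b.
rewrite (bigD1 (q.2 (if q.1 then a else b)))//= big1 => [|o].
  by rewrite addr0 /extS /extT; case: (q.1) => /=; rewrite eqxx !andbT.
rewrite /extS /extT eq_sym; case: (q.1) => /= /negbTE->.
  by rewrite andbF mul0r.
by rewrite andbF mulr0.
Qed.

Lemma sum_mass_ext b p q S T :
  \sum_o mass R b p (extS q o S) (extT q o T) = mass R b p S T.
Proof.
by rewrite -mean_sum; apply: eq_mean => F; rewrite -mulr_sumr sum_nu_ext.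
Qed.

End nu_sums.

Lemma card_parity (m : nat) (o : bool) :
  (2 * \sum_(k < m) (odd k.+1 == o) <= m.+1)%N.
Proof.
have -> : (\sum_(k < m) (odd k.+1 == o) = if o then uphalf m else m./2)%N.
  elim: m o => [|m IH] o; first by rewrite big_ord0; case: o.
  rewrite big_ord_recr/= IH uphalf_half.
  by case: o; case: (odd m) => /=; rewrite ?addn0 ?addn1 ?add0n ?add1n.
rewrite -[m.+1 in leqRHS]addn1 -{3}(odd_double_half m) uphalf_half mul2n.
by case: o; rewrite ?doubleD -?muln2; case: (odd m); lia.
Qed.

Lemma ln_bound_ge0 (R : realType) (n : nat) : 0 <= 576 * (ln n%:R + 1) :> R.
Proof.
apply: (mulr_ge0 (ler0n R 576)).
case: n => [|n]; first by rewrite ln0// add0r.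
by rewrite addr_ge0// ln_ge0// ler1n.
Qed.

(** * Analysis of a misaligned protocol, round by round *)

Section protocol.
Variables (R : realType) (m : nat) (z0 : 'I_m) (H : finType) (h0 : H) (pref : H -> H).
Variables (pS pT : nat -> bool -> H -> Defs.family m -> bool) (r : nat).
Local Notation pmap := {ffun 'I_m -> 'I_m}.
Local Notation fam := {ffun 'I_m -> {set 'I_m}}.
Local Notation query := (bool * {ffun fam -> bool})%type.
Implicit Types (F G : pmap) (b o : bool) (p : seq 'I_m) (h : H) (q : query).

Let acc j b h a1 a2 : R := (pS j b h a1)%:R * (pT j b h a2)%:R.

(* [pS j b h] and [pT j b h] tell which inputs of the two players of side b are
   consistent with the transcript h of the first j rounds, and [pref] removes
   the last round of a transcript. Side [~~ odd j] speaks in round j + 1. *)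
Hypothesis start : forall b h a, (pS 0 b h a = (h == h0)) * (pT 0 b h a = (h == h0)).
Hypothesis listen : forall j h a, (pS j.+1 (odd j) h a = pS j (odd j) (pref h) a) *
  (pT j.+1 (odd j) h a = pT j (odd j) (pref h) a).
Hypothesis speak : forall j h a1 a2,
  \sum_(h' | pref h' == h) acc j.+1 (~~ odd j) h' a1 a2 <= acc j (~~ odd j) h a1 a2.
Hypothesis cover : forall j b F G w s s' w' t t', (j <= r)%N ->
  \sum_h acc j b h (planted F w s) (planted F (negf w) s') *
         acc j (~~ b) h (planted G w' t) (planted G (negf w') t') = 1.

Let m_gt0 : (0 < m)%N. Proof. by case: m z0 => // -[]. Qed.

Lemma acc_ge0 j b h a1 a2 : 0 <= acc j b h a1 a2.
Proof. exact: mulr_ge0. Qed.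

(** Induction on the rounds: among transcripts with a common prefix, the listening side does not
    vary and the speaking side is summed by [speak]. *)
Lemma sum_acc_le1 j b a1 a2 c1 c2 :
  \sum_h acc j b h a1 a2 * acc j (~~ b) h c1 c2 <= 1.
Proof.
elim: j b a1 a2 c1 c2 => [|j IH] b a1 a2 c1 c2.
  rewrite (bigD1 h0)//= big1 ?addr0 => [|h /negbTE hh0].
    by rewrite /acc !start eqxx !mul1r.
  by rewrite /acc !start hh0 !mul0r.
wlog bj : b a1 a2 c1 c2 / b = ~~ odd j.
  move=> wl; have [|bj] := eqVneq b (~~ odd j); first exact: wl.
  have {}bj : ~~ b = ~~ odd j by move: bj; case: b; case: (odd j).
  under eq_bigr do rewrite mulrC -{2}[b]negbK; exact: wl.
rewrite bj negbK; apply: le_trans (IH b a1 a2 c1 c2); rewrite bj negbK.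
rewrite (partition_big pref xpredT)//=; apply: ler_sum => h _.
apply: le_trans (ler_wpM2r (acc_ge0 _ _ _ _ _) (speak _ _ _ _)).
rewrite mulr_suml; apply: ler_sum => h' /eqP <-.
by rewrite /acc !listen.
Qed.

Let M j b h p := mass R b p (pS j b h) (pT j b h).
Let MA j b h p x k := mass_at R b p x k (pS j b h) (pT j b h).

Lemma sum_mass_le1 j l b :
  \sum_h \sum_(p <- paths z0 l) M j b h p * M j (~~ b) h p <= 1.
Proof.
pose n j b h F := nu R (pS j b h) (pT j b h) F.
have -> : \sum_h \sum_(p <- paths z0 l) M j b h p * M j (~~ b) h p =
  mean (fun F => mean (fun G => \sum_h n j b h F * n j (~~ b) h G)).
  rewrite (eq_mean (g := fun F => \sum_h \sum_(p <- paths z0 l) mean (fun G =>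
     (follows b F p)%:R * n j b h F * ((follows (~~ b) G p)%:R * n j (~~ b) h G)))).
    rewrite mean_sum; apply: eq_bigr => h _; rewrite mean_sum; apply: eq_bigr => p _.
    by rewrite mean_prod.
  move=> F; rewrite mean_sum; apply: eq_bigr => h _; rewrite -mean_sum.
  apply: eq_mean => G.
  rewrite -[LHS](@sum_paths _ z0 R l b F G (fun=> n j b h F * n j (~~ b) h G)).
  by apply: eq_bigr => p _; ring.
apply: mean_le_const => // F; apply: mean_le_const => // G.
apply: nu_sum_le1 => a1 a2; under eq_bigr do rewrite mulrC.
apply: nu_sum_le1 => c1 c2; under eq_bigr do rewrite mulrC.
exact: sum_acc_le1.
Qed.

Definition qdisc q j b h p x : R :=
  \sum_o disc R b p x (extS q o (pS j b h)) (extT q o (pT j b h)).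

(** A constant answer, which reveals nothing. *)
Let no_query : query := (true, [ffun=> true]).

(* The most revealing final answer about the pointer at x. Taking the maximum
   makes it independent of the last message of the other pair, which may depend
   on x. *)
Definition best j b h p x : query := [arg max_(q > no_query) qdisc q j b h p x]%O.

Definition bdisc j b h p x : R := qdisc (best j b h p x) j b h p x.

Lemma qdisc_le_bdisc q j b h p x : qdisc q j b h p x <= bdisc j b h p x.
Proof. by rewrite /bdisc /best; case: arg_maxP => // q' _; apply. Qed.

Lemma bdisc_ge0 j b h p x : 0 <= bdisc j b h p x.
Proof. by apply: sumr_ge0 => o _; exact: disc_ge0. Qed.

Lemma bdisc_le j b h p x : bdisc j b h p x <= 2 * M j b h p.
Proof.
rewrite /M -(sum_mass_ext R b p (best j b h p x)) mulr_sumr.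
by apply: ler_sum => o _; exact: disc_le.
Qed.

Lemma disc_le_qdisc j b h p x :
  disc R b p x (pS j b h) (pT j b h) <= qdisc no_query j b h p x.
Proof.
rewrite /qdisc big_bool /= (@eq_disc _ _ b p x (extS no_query true _) (extT no_query true _)
  (pS j b h) (pT j b h)) ?lerDl ?disc_ge0//.
  by move=> a; rewrite /extS /= ffunE eqxx andbT.
by move=> a; rewrite /extT /= andbT.
Qed.

(* All the queries [best j b h p i], for i in 'I_m, answered by a vector v. *)
Let vS j b h p (v : {ffun 'I_m -> bool}) : Defs.family m -> bool := fun a =>
  pS j b h a && [forall i, (best j b h p i).1 ==> ((best j b h p i).2 a == v i)].
Let vT j b h p (v : {ffun 'I_m -> bool}) : Defs.family m -> bool := fun a =>
  pT j b h a && [forall i, ~~ (best j b h p i).1 ==> ((best j b h p i).2 a == v i)].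

Let answers j b h p (a1 a2 : Defs.family m) : {ffun 'I_m -> bool} :=
  [ffun i => (best j b h p i).2 (if (best j b h p i).1 then a1 else a2)].

Lemma vSTE j b h p v a1 a2 : vS j b h p v a1 && vT j b h p v a2 =
  [&& pS j b h a1, pT j b h a2 & v == answers j b h p a1 a2].
Proof.
rewrite /vS /vT; case: (pS _ _ _ _); case: (pT _ _ _ _); rewrite ?andbF//=.
apply/andP/eqP => [[/forallP vs /forallP vt]|->].
  apply/ffunP => i; rewrite ffunE.
  by have := vs i; have := vt i; case: (best j b h p i).1 => /= [_ /eqP->|/eqP-> _].
by split; apply/forallP => i; rewrite ffunE; apply/implyP; [move=> ->|move=> /negbTE->].
Qed.

Lemma sum_vST j b h p (P : pred {ffun 'I_m -> bool}) a1 a2 :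
  \sum_(v | P v) (vS j b h p v a1)%:R * (vT j b h p v a2)%:R =
  acc j b h a1 a2 * (P (answers j b h p a1 a2))%:R :> R.
Proof.
have vE v : (vS j b h p v a1)%:R * (vT j b h p v a2)%:R =
    acc j b h a1 a2 * (v == answers j b h p a1 a2)%:R :> R.
  rewrite /acc -!natrM !mulnb vSTE andbA; congr (_%:R).
under eq_bigr do rewrite vE.
rewrite -mulr_sumr; congr (_ * _); case: (boolP (P _)) => Pv.
  by rewrite (bigD1 (answers j b h p a1 a2))//= eqxx big1 ?addr0// => v /andP[_ /negbTE->].
by rewrite big1// => v Pv'; case: eqP Pv' Pv => // -> ->.
Qed.

(** One refinement by all answers serves every [i] at once: grouping the vectors by their entry at
    [i] gives back the leaf refined by the query for [i] alone. *)
Lemma nu_best j b h p i o F :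
  nu R (extS (best j b h p i) o (pS j b h)) (extT (best j b h p i) o (pT j b h)) F =
  \sum_(v : {ffun 'I_m -> bool} | v i == o) nu R (vS j b h p v) (vT j b h p v) F.
Proof.
apply: nu_sum => a1 a2; rewrite sum_vST ffunE /acc /extS /extT -!natrM !mulnb.
congr (_%:R); rewrite andbACA; congr (_ && _).
by case: ((best j b h p i).1); rewrite /= ?andbT.
Qed.

Let variation j b h p F i : R := \sum_k \sum_v
  sqdist (nu R (vS j b h p v) (vT j b h p v) F)
         (nu R (vS j b h p v) (vT j b h p v) (upd F i k)).

Lemma bdisc_hidden j b h p i : i \notin p ->
  bdisc j b h p i <= m%:R^-1 * mean (fun F => (follows b F p)%:R * variation j b h p F i).
Proof.
move=> ip; rewrite /bdisc /qdisc.
set q := best j b h p i.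
apply: (@le_trans _ _ (\sum_o m%:R^-1 * mean (fun F => (follows b F p)%:R *
     \sum_k sqdist (nu R (extS q o (pS j b h)) (extT q o (pT j b h)) F)
       (nu R (extS q o (pS j b h)) (extT q o (pT j b h)) (upd F i k))))).
  by apply: ler_sum => o _; apply: disc_hidden => // F k; exact: follows_upd.
rewrite -mulr_sumr ler_wpM2l ?invr_ge0// -mean_sum; apply: ler_mean => F.
rewrite -mulr_sumr ler_wpM2l// exchange_big; apply: ler_sum => k _ /=.
rewrite [leRHS](partition_big (fun v : {ffun 'I_m -> bool} => v i) xpredT)//=.
apply: ler_sum => o _; rewrite !nu_best.
by apply: sqdist_sum => v; exact: nu_ge0.
Qed.

(** The factor 2 ^ m counts the answer vectors. Its logarithm is at most m, so after division by m
    it contributes only a constant. *)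
Let bound : R := 576 * (ln (#|H| * 2 ^ m)%:R + 1).

(** Once the function and inputs of the other pair are fixed, the leaves consistent with them form a
    family of rectangles for side [b]; their refinement depends on [F] only through the walk, which
    plays the part of [z]. *)
Lemma sum_variation j l b G w' t t' : (j <= r)%N ->
  mean (fun F => \sum_h acc j (~~ b) h (planted G w' t) (planted G (negf w') t') *
    \sum_(i | i \notin walk z0 l b F G) variation j b h (walk z0 l b F G) F i) <= bound.
Proof.
move=> jr; pose c h := pS j (~~ b) h (planted G w' t) && pT j (~~ b) h (planted G (negf w') t').
have cE h : acc j (~~ b) h (planted G w' t) (planted G (negf w') t') = (c h)%:R.
  by rewrite /acc -natrM mulnb.
pose S' p (hv : H * {ffun 'I_m -> bool}) a := c hv.1 && vS j b hv.1 p hv.2 a.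
pose T' p (hv : H * {ffun 'I_m -> bool}) := vT j b hv.1 p hv.2.
have sumST p a1 a2 : \sum_hv (S' p hv a1)%:R * (T' p hv a2)%:R =
    \sum_h acc j b h a1 a2 * acc j (~~ b) h (planted G w' t) (planted G (negf w') t') :> R.
  rewrite -(pair_bigA _ (fun h v => (S' p (h, v) a1)%:R * (T' p (h, v) a2)%:R)) /=.
  apply: eq_bigr => h _; rewrite cE.
  under eq_bigr do rewrite /S' /T' /= -mulnb natrM -mulrA.
  by rewrite -mulr_sumr sum_vST mulr1 mulrC.
have disjST p a1 a2 : \sum_hv (S' p hv a1)%:R * (T' p hv a2)%:R <= 1 :> R.
  by rewrite sumST; exact: sum_acc_le1.
have coverST p F w s s' : \sum_hv (S' p hv (planted F w s))%:R *
    (T' p hv (planted F (negf w) s'))%:R = 1 :> R.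
  by rewrite sumST; exact: cover.
have := @planted_pointer_hidden R m _ (fun F => walk z0 l b F G) _ S' T' disjST coverST.
rewrite card_prod card_ffun card_bool card_ord; apply: le_trans.
apply: ler_mean => F; under eq_bigr do rewrite mulr_sumr.
rewrite exchange_big [leRHS](bigID (fun x => x \notin walk z0 l b F G)) /=.
apply: ler_wpDr.
  apply: sumr_ge0 => x _; apply: sumr_ge0 => k _.
  by rewrite mulr_ge0// sumr_ge0// => hv _; exact: sqdist_ge0.
apply: ler_sum => x xw; rewrite /variation.
under eq_bigr do rewrite mulr_sumr.
(* A change of [F] off the walk does not alter the walk. *)
rewrite exchange_big; apply: ler_sum => k _ /=; rewrite walk_upd// eqxx mul1r.
rewrite -(pair_bigA _ (fun h v => sqdist (nu R (S' _ (h, v)) (T' _ (h, v)) F)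
    (nu R (S' _ (h, v)) (T' _ (h, v)) (upd F x k)))) /=.
apply: ler_sum => h _; rewrite cE mulr_sumr; apply: ler_sum => v _.
by rewrite /S' /T' /= !nu_andl sqdistMl.
Qed.

(** The at most l + 1 visited vertices get the trivial bound [bdisc_le]; the others are hidden, by
    [sum_variation] averaged over the other side. *)
Lemma sum_bdisc j l b : (j <= r)%N ->
  \sum_h \sum_(p <- paths z0 l) M j (~~ b) h p * \sum_i bdisc j b h p i <=
  2 * l.+1%:R + m%:R^-1 * bound.
Proof.
move=> jr.
pose hid h p := mean (fun F => (follows b F p)%:R *
  \sum_(i | i \notin p) variation j b h p F i).
have split_path h p : p \in paths z0 l -> \sum_i bdisc j b h p i <=
    2 * l.+1%:R * M j b h p + m%:R^-1 * hid h p.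
  move=> /size_paths sp; rewrite (bigID (mem p))/=; apply: lerD.
    apply: (@le_trans _ _ (\sum_(i in p) 2 * M j b h p)).
      by apply: ler_sum => i _; exact: bdisc_le.
    rewrite sumr_const -[_ *+ _]mulr_natr mulrAC ler_wpM2r ?mass_ge0// ler_wpM2l//.
    by rewrite ler_nat -sp card_size.
  rewrite /hid; under eq_mean do rewrite mulr_sumr.
  rewrite mean_sum mulr_sumr; apply: ler_sum => i; exact: bdisc_hidden.
apply: (@le_trans _ _ (\sum_h \sum_(p <- paths z0 l)
   (2 * l.+1%:R * (M j (~~ b) h p * M j b h p) + m%:R^-1 * (M j (~~ b) h p * hid h p)))).
  apply: ler_sum => h _; rewrite big_seq [leRHS]big_seq; apply: ler_sum => p pl.
  rewrite mulrCA [m%:R^-1 * _]mulrCA -mulrDr ler_wpM2l ?mass_ge0//.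
  exact: split_path.
under eq_bigr do rewrite big_split/= -!mulr_sumr.
rewrite big_split/= -!mulr_sumr; apply: lerD.
  rewrite -[leRHS]mulr1 ler_wpM2l ?mulr_ge0//.
  by have := sum_mass_le1 j l (~~ b); rewrite negbK.
rewrite ler_wpM2l ?invr_ge0//.
pose n h G := nu R (pS j (~~ b) h) (pT j (~~ b) h) G.
pose V h p F := \sum_(i | i \notin p) variation j b h p F i.
have -> : \sum_h \sum_(p <- paths z0 l) M j (~~ b) h p * hid h p =
  mean (fun G => mean (fun F => \sum_h n h G * V h (walk z0 l b F G) F)).
  rewrite (eq_mean (g := fun G => \sum_h \sum_(p <- paths z0 l) mean (fun F =>
     ((follows (~~ b) G p)%:R * n h G) * ((follows b F p)%:R * V h p F)))).
    rewrite mean_sum; apply: eq_bigr => h _; rewrite mean_sum; apply: eq_bigr => p _.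
    by rewrite mean_prod.
  move=> G; rewrite mean_sum; apply: eq_bigr => h _; rewrite -mean_sum.
  apply: eq_mean => F.
  rewrite -[LHS](@sum_paths _ z0 R l b F G (fun p => n h G * V h p F)).
  by apply: eq_bigr => p _; ring.
have bound0 : 0 <= bound by exact: ln_bound_ge0.
apply: mean_le_const => // G.
rewrite (eq_mean (g := fun F => mean (fun w' => mean (fun t => mean (fun t' =>
  \sum_h acc j (~~ b) h (planted G w' t) (planted G (negf w') t') *
     V h (walk z0 l b F G) F))))).
  rewrite mean_exchange; apply: mean_le_const => // w'.
  rewrite mean_exchange; apply: mean_le_const => // t.
  rewrite mean_exchange; apply: mean_le_const => // t'.
  exact: sum_variation.
move=> F.
under eq_bigr do rewrite /n nu_meanE -meanZr.
rewrite -mean_sum; apply: eq_mean => w'.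
under eq_bigr do rewrite -meanZr.
rewrite -mean_sum; apply: eq_mean => t.
under eq_bigr do rewrite -meanZr.
by rewrite -mean_sum; apply: eq_mean => t'.
Qed.

Definition excess j b h p x : R :=
  \sum_k Num.max (MA j b h p x k - 2 * (M j b h p / m%:R)) 0.

Lemma excess_ge0 j b h p x : 0 <= excess j b h p x.
Proof. by apply: sumr_ge0 => k _; rewrite le_max lexx orbT. Qed.

Lemma excess_le_mass j b h p x : excess j b h p x <= M j b h p.
Proof.
rewrite -[leRHS](sum_mass_at R b p x); apply: ler_sum => k _.
rewrite ge_max mass_at_ge0 andbT gerBl mulr_ge0// divr_ge0// mass_ge0//.
Qed.

Lemma excess_le_bdisc j b h p x : excess j b h p x <= 2 * bdisc j b h p x.
Proof.
apply: (@le_trans _ _ (2 * disc R b p x (pS j b h) (pT j b h))).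
  rewrite mulr_sumr; apply: ler_sum => k _; apply: excess_le; first exact: mass_at_ge0.
  by rewrite divr_ge0 ?mass_ge0.
by rewrite ler_wpM2l// (le_trans (disc_le_qdisc _ _ _ _ _))// qdisc_le_bdisc.
Qed.

(* The probability that, after j + 1 rounds, the next pointer falls in the part
   of its conditional distribution that exceeds twice the uniform one. *)
Definition bad j : R := \sum_h \sum_(p <- paths z0 j)
  M j.+1 (~~ odd j) h p * excess j.+1 (odd j) h p (head z0 p).

(** Side [odd j] makes the step from [head z0 p] and also speaks in round j + 2: [speak] sums out
    its message, and the test of the new step leaves the event that the pointer is [i]. *)
Lemma sum_mass_speak j h p i : p \in paths z0 j ->
  \sum_(h' | pref h' == h) M j.+2 (odd j) h' (i :: p) <=
  MA j.+1 (odd j) h p (head z0 p) i.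
Proof.
move=> /size_paths sp; rewrite -mean_sum; apply: ler_mean => F.
rewrite -mulr_sumr (@follows_cons _ z0) ?sp//= eqxx /= -mulnb natrM -mulrA.
rewrite !ler_wpM2l//; apply: (@le_trans _ _ (mean (fun w => mean (fun s => mean (fun s' =>
   \sum_(h' | pref h' == h) acc j.+2 (odd j) h' (planted F w s) (planted F (negf w) s')))))).
  under eq_bigr do rewrite nu_meanE.
  rewrite -mean_sum; apply: ler_mean => w; rewrite -mean_sum; apply: ler_mean => s.
  by rewrite -mean_sum.
rewrite nu_meanE; do 3 apply: ler_mean => ?.
by have := speak j.+1 h; rewrite /= negbK; apply.
Qed.

(** The probability of each next vertex is at most twice the uniform one plus the excess. The excess
    is charged to [bad] by the bound on [Q]; the rest is a uniform average of [Q]. *)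
Lemma sum_next j c (Q : H -> seq 'I_m -> 'I_m -> R) :
  (forall h p i, 0 <= Q h p i) -> (forall h p i, Q h p i <= c * M j.+1 (~~ odd j) h p) ->
  \sum_h \sum_(p <- paths z0 j) \sum_i M j.+2 (odd j) h (i :: p) * Q (pref h) p i <=
  c * bad j + 2 / m%:R * (\sum_h \sum_(p <- paths z0 j)
                            M j.+1 (odd j) h p * \sum_i Q h p i).
Proof.
move=> Q0 Qc; rewrite (partition_big pref xpredT)//=.
rewrite /bad [c * _]mulr_sumr [2 / _ * _]mulr_sumr -big_split; apply: ler_sum => h _ /=.
rewrite exchange_big [c * _]mulr_sumr [2 / _ * _]mulr_sumr -big_split big_seq [leRHS]big_seq.
apply: ler_sum => p pj /=; rewrite exchange_big /excess !mulr_sumr -big_split /=.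
apply: ler_sum => i _; set x := head z0 p.
apply: (@le_trans _ _ (MA j.+1 (odd j) h p x i * Q h p i)).
  apply: le_trans (ler_wpM2r (Q0 _ _ _) (sum_mass_speak h i pj)).
  by rewrite mulr_suml; apply: ler_sum => h' /eqP->.
set e := Num.max (MA j.+1 (odd j) h p x i - 2 * (M j.+1 (odd j) h p / m%:R)) 0.
apply: (@le_trans _ _ ((e + 2 * (M j.+1 (odd j) h p / m%:R)) * Q h p i)).
  by rewrite ler_wpM2r// -lerBlDr le_max lexx.
rewrite mulrDl lerD//; last first.
  by rewrite le_eqVlt; apply/orP; left; apply/eqP; ring.
have e0 : 0 <= e by rewrite le_max lexx orbT.
apply: (le_trans (ler_wpM2l e0 (Qc _ _ _))).
by rewrite mulrC -mulrA.
Qed.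

Lemma follows_listen j F p i : p \in paths z0 j ->
  follows (odd j.+1) F (i :: p) = follows (odd j.+1) F p.
Proof.
by move=> /size_paths sp; rewrite (@follows_cons _ z0) ?sp//=; case: (odd j).
Qed.

Lemma mass_listen j p i S T : p \in paths z0 j ->
  mass R (odd j.+1) (i :: p) S T = mass R (odd j.+1) p S T.
Proof. by move=> pj; apply: eq_mean => F; rewrite (follows_listen F i pj). Qed.

Lemma mass_at_listen j p i x k S T : p \in paths z0 j ->
  mass_at R (odd j.+1) (i :: p) x k S T = mass_at R (odd j.+1) p x k S T.
Proof. by move=> pj; apply: eq_mean => F; rewrite (follows_listen F i pj). Qed.

(** Neither the new step nor the new message comes from the listening side. *)
Lemma qdisc_listen q j h p i x : p \in paths z0 j ->
  qdisc q j.+2 (odd j.+1) h (i :: p) x = qdisc q j.+1 (odd j.+1) (pref h) p x.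
Proof.
move=> pj; apply: eq_bigr => o _.
transitivity (disc R (odd j.+1) (i :: p) x (extS q o (pS j.+1 (odd j.+1) (pref h)))
                                          (extT q o (pT j.+1 (odd j.+1) (pref h)))).
  by apply: eq_disc => a; rewrite /extS /extT listen.
by apply: eq_bigr => k _; rewrite mass_listen// mass_at_listen.
Qed.

Lemma excess_listen j h p i x : p \in paths z0 j ->
  excess j.+2 (odd j.+1) h (i :: p) x = excess j.+1 (odd j.+1) (pref h) p x.
Proof.
move=> pj; apply: eq_bigr => k _; rewrite /M /MA mass_listen// mass_at_listen//.
rewrite (@eq_mass _ _ _ _ _ _ (pS j.+1 (odd j.+1) (pref h)) (pT j.+1 (odd j.+1) (pref h))).
- rewrite (@eq_mass_at _ _ _ _ _ _ _ _ (pS j.+1 (odd j.+1) (pref h))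
    (pT j.+1 (odd j.+1) (pref h)))// => a; by rewrite listen.
- by move=> a; rewrite listen.
- by move=> a; rewrite listen.
Qed.

Let delta : R := 2 * r%:R + m%:R^-1 * bound.

Lemma sum_bdisc_delta j : (j < r)%N ->
  \sum_h \sum_(p <- paths z0 j) M j.+1 (odd j) h p * \sum_i bdisc j.+1 (~~ odd j) h p i <=
  delta.
Proof.
move=> jr; have := @sum_bdisc j.+1 j (~~ odd j) jr; rewrite negbK => /le_trans; apply.
by rewrite lerD2r ler_wpM2l// ler_nat.
Qed.

(** Misalignment: P_C and P_D speak first, so after round 1 the pointer at [z0] is still uniform. *)
Lemma bad0 : bad 0 = 0.
Proof.
rewrite /bad big1// => h _; rewrite /= big_seq1; apply/eqP; rewrite mulf_eq0; apply/orP; right.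
apply/eqP; apply: big1 => k _.
rewrite /MA /M /mass_at /mass mean_preim card_ord.
have nuE F : nu R (pS 1 false h) (pT 1 false h) F = (pref h == h0)%:R.
  by rewrite -(nu_const R _ F); apply: eq_nu => a; rewrite (listen 0 h a) start.
under eq_mean do rewrite nuE /=.
under [X in _ - 2 * (X / _)]eq_mean do rewrite nuE /=.
rewrite [_ / m%:R]mulrC; apply/max_idPr.
set a := mean _; have a0 : 0 <= m%:R^-1 * a.
  by rewrite mulr_ge0 ?invr_ge0//; apply: mean_ge0 => F; rewrite mulr_ge0 ?nu_ge0.
lra.
Qed.

(** In the constant 4, one factor 2 comes from [sum_next] and the other from [excess_le_bdisc]. *)
Lemma bad_step j : (j < r)%N -> bad j.+1 <= bad j + 4 / m%:R * delta.
Proof.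
move=> jr; pose Q h p i := excess j.+1 (~~ odd j) h p i.
apply: (@le_trans _ _ (\sum_h \sum_(p <- paths z0 j) \sum_i
    M j.+2 (odd j) h (i :: p) * Q (pref h) p i)).
  apply: ler_sum => h _; rewrite big_paths_cons big_seq [leRHS]big_seq.
  apply: ler_sum => p pj; apply: ler_sum => i _.
  by rewrite excess_listen//= negbK.
apply: (le_trans (@sum_next j 1 Q _ _)).
- by move=> h p i; exact: excess_ge0.
- by move=> h p i; rewrite mul1r; exact: excess_le_mass.
rewrite mul1r lerD2l.
apply: (@le_trans _ _ (2 / m%:R * (2 * delta))); last first.
  by rewrite le_eqVlt; apply/orP; left; apply/eqP; ring.
rewrite ler_wpM2l ?divr_ge0//.
apply: le_trans (ler_wpM2l _ (sum_bdisc_delta jr)) => //.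
rewrite mulr_sumr; apply: ler_sum => h _; rewrite mulr_sumr; apply: ler_sum => p _.
rewrite mulrCA ler_wpM2l ?mass_ge0// mulr_sumr; apply: ler_sum => i _.
exact: excess_le_bdisc.
Qed.

Lemma bad_le j : (j <= r)%N -> bad j <= 4 * j%:R / m%:R * delta.
Proof.
elim: j => [_|j IH jr]; first by rewrite bad0 mulr0 !mul0r.
apply: (le_trans (bad_step jr)); have := IH (ltnW jr).
move: (bad j) delta => x y h; rewrite -addn1 natrD; apply: (le_trans (lerD h (lexx _))).
by rewrite le_eqVlt; apply/orP; left; apply/eqP; ring.
Qed.

Let err l (q : H -> seq 'I_m -> query) : R := \sum_h \sum_(p <- paths z0 l)
  M l.+1 (~~ odd l) h p * qdisc (q h p) l.+1 (odd l) h p (head z0 p).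

Lemma ln2_le1 : ln (2 : R) <= 1.
Proof.
have h : (-1 : R) < 1 by lra.
by have := le_ln1Dx h; rewrite (_ : 1 + 1 = 2 :> R)//; lra.
Qed.

(* The case r = 1: P_A and P_B have not spoken, but one of them may answer. *)
Lemma qdisc_first q h :
  qdisc q 1 false h [:: z0] z0 <= M 1 false h [:: z0] * (1152 / m%:R).
Proof.
pose c := pref h == h0.
pose N o F := nu R (extS q o xpredT) (extT q o xpredT) F.
have nuE F : nu R (pS 1 false h) (pT 1 false h) F = c%:R.
  by rewrite -(nu_const R _ F); apply: eq_nu => a; rewrite (listen 0 h a) start.
have extE o F : nu R (extS q o (pS 1 false h)) (extT q o (pT 1 false h)) F = c%:R * N o F.
  rewrite (@eq_nu _ _ _ _ (fun a => c && extS q o xpredT a) (fun a => c && extT q o xpredT a)).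
  - by rewrite nu_andl /c; case: (pref h == h0); rewrite ?mul0r.
  - by move=> a; rewrite /extS (listen 0 h a) start.
  - by move=> a; rewrite /extT (listen 0 h a) start.
have -> : M 1 false h [:: z0] = c%:R.
  have f0 : (0 < #|pmap|)%N by apply/card_gt0P; exists [ffun i => i].
  by rewrite -[RHS](mean_const _ f0); apply: eq_mean => F; rewrite mul1r nuE.
apply: (@le_trans _ _ (c%:R * (m%:R^-1 * mean (fun F => \sum_k \sum_o
    sqdist (N o F) (N o (upd F z0 k)))))).
  rewrite /qdisc.
  apply: (@le_trans _ _ (\sum_o m%:R^-1 * mean (fun F => (follows false F [:: z0])%:R *
     \sum_k sqdist (nu R (extS q o (pS 1 false h)) (extT q o (pT 1 false h)) F)
       (nu R (extS q o (pS 1 false h)) (extT q o (pT 1 false h)) (upd F z0 k))))).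
    by apply: ler_sum => o _; exact: disc_hidden.
  rewrite -mulr_sumr mulrCA ler_wpM2l ?invr_ge0// -mean_sum -meanZ; apply: ler_mean => F.
  rewrite exchange_big mulr_sumr; apply: ler_sum => o _; rewrite mul1r mulr_sumr.
  by apply: ler_sum => k _; rewrite !extE sqdistMl.
apply: ler_wpM2l => //; rewrite mulrC; apply: ler_wpM2r; first by rewrite invr_ge0.
have sumST a1 a2 : \sum_o (extS q o xpredT a1)%:R * (extT q o xpredT a2)%:R = 1 :> R.
  rewrite (bigD1 (q.2 (if q.1 then a1 else a2)))//= big1 => [|o].
    by rewrite /extS /extT; case: (q.1) => /=; rewrite eqxx mul1r addr0.
  by rewrite /extS /extT eq_sym; case: (q.1) => /= /negbTE->; rewrite ?mul0r ?mulr0.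
have le1 (_ : unit) a1 a2 : \sum_o (extS q o xpredT a1)%:R * (extT q o xpredT a2)%:R <= 1 :> R.
  by rewrite sumST.
have hid := @planted_pointer_hidden R m unit (fun=> tt) bool
  (fun _ o => extS q o xpredT) (fun _ o => extT q o xpredT) le1 (fun _ _ _ _ _ => sumST _ _).
apply: (le_trans (le_trans _ hid)); last first.
  rewrite card_bool (_ : 1152 = 576 * (1 + 1) :> R); last by rewrite mulrDr mulr1 -natrD.
  by apply: (ler_wpM2l (ler0n R 576)); rewrite lerD2r ln2_le1.
apply: ler_mean => F; rewrite [leRHS](bigD1 z0)//=; apply: ler_wpDr.
  apply: sumr_ge0 => x _; apply: sumr_ge0 => k _.
  by rewrite mulr_ge0// sumr_ge0// => o _; exact: sqdist_ge0.
by apply: ler_sum => k _; rewrite mul1r.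
Qed.

Lemma err_le (qs : H -> seq 'I_m -> query) l : r = l.+1 ->
  err l qs <= 8 * r%:R / m%:R * delta + 1152 / m%:R.
Proof.
have bound0 : 0 <= bound by exact: ln_bound_ge0.
have mV0 : 0 <= m%:R^-1 :> R by rewrite invr_ge0.
have delta0 : 0 <= delta.
  exact: (addr_ge0 (mulr_ge0 (ler0n R 2) (ler0n R r)) (mulr_ge0 mV0 bound0)).
have big0 : 0 <= 8 * r%:R / m%:R * delta.
  exact: (mulr_ge0 (mulr_ge0 (mulr_ge0 (ler0n R 8) (ler0n R r)) mV0)).
have small0 : 0 <= 1152 / m%:R :> R by exact: (mulr_ge0 (ler0n R 1152)).
case: l => [|j] rE.
  apply: (@le_trans _ _ (\sum_h \sum_(p <- paths z0 0)
      M 1 (~~ false) h p * M 1 false h p * (1152 / m%:R))).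
    apply: ler_sum => h _; rewrite /= !big_seq1 -mulrA ler_wpM2l ?mass_ge0//.
    exact: qdisc_first.
  under eq_bigr do rewrite -mulr_suml.
  rewrite -mulr_suml; apply: (ler_wpDl big0).
  rewrite -[leRHS]mul1r; apply: ler_wpM2r; first exact: small0.
  exact: (sum_mass_le1 1 0 true).
have jr : (j < r)%N by rewrite rE ltnS leqnSn.
apply: (ler_wpDr small0).
(* The query of the output player may depend on the last message; its maximum [bdisc] depends only
   on the prefix, as [sum_next] requires. *)
pose Q h p i := bdisc j.+1 (~~ odd j) h p i.
apply: (@le_trans _ _ (\sum_h \sum_(p <- paths z0 j) \sum_i
    M j.+2 (odd j) h (i :: p) * Q (pref h) p i)).
  apply: ler_sum => h _; rewrite big_paths_cons big_seq [leRHS]big_seq.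
  apply: ler_sum => p pj; apply: ler_sum => i _.
  rewrite qdisc_listen//= negbK ler_wpM2l ?mass_ge0//; exact: qdisc_le_bdisc.
apply: (le_trans (@sum_next j 2 Q _ _)).
- by move=> h p i; exact: bdisc_ge0.
- by move=> h p i; exact: bdisc_le.
have h1 := bad_le (ltnW jr); have h2 := sum_bdisc_delta jr.
apply: (le_trans (lerD (ler_wpM2l _ h1) (ler_wpM2l _ h2))) => //.
rewrite rE; move: delta0; move: delta => x x0.
rewrite (_ : 2 * _ + _ = (8 * j%:R + 2) / m%:R * x); last by ring.
rewrite ler_wpM2r// ler_wpM2r ?invr_ge0// -[j.+2]addn2 natrD; lra.
Qed.

(** Each mass is compared with the uniform one by [absdist_le]. The term 1 / (2 m) is due to odd m,
    where the parities are unbalanced. *)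
Lemma parity_mass_le (lam : R) b p x S T o : 0 < lam ->
  \sum_(k < m | odd k.+1 == o) mass_at R b p x k S T <=
  (2^-1 + (2 * m%:R)^-1 + 2 / lam) * mass R b p S T + lam / 2 * disc R b p x S T.
Proof.
move=> l0; set A := mass R b p S T.
have A0 : 0 <= A by exact: mass_ge0.
have mR : 0 < m%:R :> R by rewrite ltr0n.
have Am0 : 0 <= A / m%:R by rewrite divr_ge0.
pose f k := lam / 2 * sqdist (mass_at R b p x k S T) (A / m%:R) +
            lam^-1 * (mass_at R b p x k S T + A / m%:R).
have f0 k : 0 <= f k.
  by apply: addr_ge0; apply: mulr_ge0;
     rewrite ?sqdist_ge0 ?divr_ge0 ?invr_ge0 ?addr_ge0 ?mass_at_ge0 ?(ltW l0).
apply: (@le_trans _ _ (\sum_(k < m | odd k.+1 == o) (A / m%:R + f k))).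
  apply: ler_sum => k _; rewrite -lerBlDl; apply: absdist_le => //.
  exact: mass_at_ge0.
rewrite big_split/=.
have h1 : \sum_(k < m | odd k.+1 == o) A / m%:R <= (2^-1 + (2 * m%:R)^-1) * A.
  rewrite sumr_const -[_ *+ _]mulr_natr mulrAC ler_pdivrMr//.
  have -> : (2^-1 + (2 * m%:R)^-1) * A * m%:R = A * ((m.+1)%:R / 2) :> R.
    by rewrite -addn1 natrD; field; rewrite gt_eqF.
  rewrite ler_wpM2l// ler_pdivlMr// -natrM ler_nat mulnC.
  by rewrite -sum1_card big_mkcond; exact: card_parity.
have h2 : \sum_(k < m | odd k.+1 == o) f k <= lam / 2 * disc R b p x S T + 2 / lam * A.
  apply: (@le_trans _ _ (\sum_k f k)).
    by rewrite [leRHS](bigID (fun k : 'I_m => odd k.+1 == o))/= lerDl sumr_ge0.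
  rewrite big_split/= -!mulr_sumr big_split/= sum_mass_at sum_mass_div//.
  rewrite /disc -/A; apply: lerD => //.
  by rewrite le_eqVlt; apply/orP; left; apply/eqP; ring.
move: h1 h2; move: (\sum_(_ < _ | _) _) (\sum_(_ < _ | _) _) (disc _ _ _ _ _ _) => u v d.
by move=> h1 h2; lra.
Qed.

(** * Success probability over the hard inputs *)

Section output.
Variables (l : nat) (side first : bool) (O : H -> {ffun fam -> bool}).
Hypothesis rE : r = l.+1.
Let b := odd l.

(** Only the side of the output player is refined by the answer [o]. *)
Let oS d o h := if d == side then extS (first, O h) o (pS r d h) else pS r d h.
Let oT d o h := if d == side then extT (first, O h) o (pT r d h) else pT r d h.

Lemma mean_parity S T S' T' o :
  mean (fun F => mean (fun G => nu R S T F * nu R S' T' G *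
    (odd (head z0 (walk z0 l.+1 b F G)).+1 == o)%:R)) =
  \sum_(p <- paths z0 l) mass R (~~ b) p S' T' *
    \sum_(k < m | odd k.+1 == o) mass_at R b p (head z0 p) k S T.
Proof.
under [RHS]eq_bigr do rewrite mulr_sumr.
transitivity (mean (fun F => mean (fun G => \sum_(p <- paths z0 l)
   \sum_(k < m | odd k.+1 == o)
     ((F (head z0 p) == k)%:R * ((follows b F p)%:R * nu R S T F)) *
     ((follows (~~ b) G p)%:R * nu R S' T' G)))).
  apply: eq_mean => F; apply: eq_mean => G; rewrite /= eqxx.
  rewrite -[LHS](@sum_paths _ z0 R l b F G
    (fun p => nu R S T F * nu R S' T' G * (odd (F (head z0 p)).+1 == o)%:R)).
  apply: eq_bigr => p _.
  have -> : (odd (F (head z0 p)).+1 == o)%:R =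
      \sum_(k < m | odd k.+1 == o) (F (head z0 p) == k)%:R :> R.
    case: (boolP (_ == o)) => [Fo|/negbTE Fo].
      rewrite (bigD1 (F (head z0 p)))//= eqxx big1 ?addr0// => k /andP[_ /negbTE].
      by rewrite eq_sym => ->.
    rewrite big1// => k ko; have /negbTE-> // : F (head z0 p) != k.
    by apply: contraFN Fo => /eqP->.
  by rewrite !mulr_sumr; apply: eq_bigr => k _; ring.
under eq_mean do rewrite mean_sum.
rewrite mean_sum; apply: eq_bigr => p _.
under eq_mean do rewrite mean_sum.
rewrite mean_sum; apply: eq_bigr => k _.
by rewrite mean_prod mulrC.
Qed.

Lemma sum_output_le (lam : R) : 0 < lam ->
  mean (fun F => mean (fun G => \sum_h \sum_o
    nu R (oS b o h) (oT b o h) F * nu R (oS (~~ b) o h) (oT (~~ b) o h) G *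
    (odd (head z0 (walk z0 l.+1 b F G)).+1 == o)%:R)) <=
  2^-1 + (2 * m%:R)^-1 + 2 / lam +
  lam / 2 * (8 * r%:R / m%:R * delta + 1152 / m%:R).
Proof.
move=> l0; set kap := 2^-1 + _ + _.
have kap0 : 0 <= kap by rewrite !addr_ge0 ?invr_ge0 ?mulr_ge0 ?invr_ge0 ?(ltW l0).
have lam2 : 0 <= lam / 2 by rewrite divr_ge0 ?ltW.
pose qs (h : H) (p : seq 'I_m) : query := if b == side then (first, O h) else no_query.
apply: (@le_trans _ _ (\sum_h \sum_(p <- paths z0 l) (kap * (M r b h p * M r (~~ b) h p) +
   lam / 2 * (M r (~~ b) h p * qdisc (qs h p) r b h p (head z0 p))))).
  under eq_mean do rewrite mean_sum.
  rewrite mean_sum; apply: ler_sum => h _.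
  under eq_mean do rewrite mean_sum.
  rewrite mean_sum; under eq_bigr do rewrite mean_parity.
  rewrite exchange_big; apply: ler_sum => p _ /=.
  set x := head z0 p.
  apply: (@le_trans _ _ (\sum_o mass R (~~ b) p (oS (~~ b) o h) (oT (~~ b) o h) *
    (kap * mass R b p (oS b o h) (oT b o h) + lam / 2 * disc R b p x (oS b o h) (oT b o h)))).
    by apply: ler_sum => o _; rewrite ler_wpM2l ?mass_ge0//; exact: parity_mass_le.
  (* If the output player is on the other side, its answer is summed out there and side [b] is asked
     nothing. *)
  rewrite /qs; have [bs|bs] := eqVneq b side.
    have nbs : (~~ b == side) = false by rewrite -bs; case: (b).
    under eq_bigr do rewrite /oS /oT nbs (introT eqP bs).
    rewrite -mulr_sumr big_split/= -!mulr_sumr sum_mass_ext mulrDr.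
    by rewrite mulrCA [X in _ + X]mulrCA [M r b h p * _]mulrC.
  have nbs : ~~ b == side by move: bs; case: (b); case: (side).
  under eq_bigr do rewrite /oS /oT (negbTE bs) nbs.
  rewrite -mulr_suml sum_mass_ext mulrDr mulrCA [X in _ + X]mulrCA [M r b h p * _]mulrC.
  rewrite lerD2l ler_wpM2l// ler_wpM2l ?mass_ge0//; exact: disc_le_qdisc.
under eq_bigr do rewrite big_split/= -!mulr_sumr.
rewrite big_split/= -!mulr_sumr; apply: lerD.
  by rewrite -[leRHS]mulr1 ler_wpM2l// sum_mass_le1.
by rewrite ler_wpM2l//; have := err_le qs rE; rewrite /err -rE.
Qed.

Lemma output_le (lam : R) (out : Defs.family m -> Defs.family m -> Defs.family m ->
    Defs.family m -> bool) : 0 < lam ->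
  (forall F G w s s' w' t t',
     let a1 := planted F w s in let a2 := planted F (negf w) s' in
     let c1 := planted G w' t in let c2 := planted G (negf w') t' in
     exists h, [/\ pS r b h a1 && pT r b h a2, pS r (~~ b) h c1 && pT r (~~ b) h c2 &
       out a1 a2 c1 c2 = O h (if b == side then if first then a1 else a2
                              else if first then c1 else c2)]) ->
  mean (fun F => mean (fun G => mean (fun w => mean (fun s => mean (fun s' =>
    mean (fun w' => mean (fun t => mean (fun t' =>
    (out (planted F w s) (planted F (negf w) s')
         (planted G w' t) (planted G (negf w') t') ==
     odd (head z0 (walk z0 l.+1 b F G)).+1)%:R)))))))) <=
  2^-1 + (2 * m%:R)^-1 + 2 / lam +
  lam / 2 * (8 * r%:R / m%:R * delta + 1152 / m%:R).
Proof.
move=> l0 correct; apply: le_trans (sum_output_le l0).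
apply: ler_mean => F; apply: ler_mean => G.
set ans := odd _.
apply: (@le_trans _ _ (mean (fun w => mean (fun s => mean (fun s' =>
    mean (fun w' => mean (fun t => mean (fun t' => \sum_h \sum_o
      ((oS b o h (planted F w s))%:R * (oT b o h (planted F (negf w) s'))%:R) *
      ((oS (~~ b) o h (planted G w' t))%:R * (oT (~~ b) o h (planted G (negf w') t'))%:R) *
      (ans == o)%:R)))))))).
  apply: ler_mean => w; apply: ler_mean => s; apply: ler_mean => s'.
  apply: ler_mean => w'; apply: ler_mean => t; apply: ler_mean => t'.
  have [h [ha hc outE]] := correct F G w s s' w' t t'.
  case: (boolP (out _ _ _ _ == ans)) => [/eqP oa|_]; last first.
    by do 2 apply: sumr_ge0 => ? _; rewrite !mulr_ge0.
  rewrite (bigD1 h)//= (bigD1 ans)//=; apply: ler_wpDr.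
    by do 2 apply: sumr_ge0 => ? _; rewrite !mulr_ge0.
  apply: ler_wpDr; first by apply: sumr_ge0 => ? _; rewrite !mulr_ge0.
  rewrite -oa outE eqxx mulr1 -!natrM !mulnb ler_nat lt0b.
  move: ha hc => /andP[a1 a2] /andP[c1 c2]; rewrite /oS /oT.
  have [bs|bs] := eqVneq b side.
    have -> : (~~ b == side) = false by rewrite -bs; case: (b).
    by rewrite /extS /extT a1 a2 c1 c2 /=; case: (first); rewrite /= eqxx.
  have -> : (~~ b == side) by move: bs; case: (b); case: (side).
  by rewrite /extS /extT a1 a2 c1 c2 /=; case: (first); rewrite /= eqxx.
rewrite le_eqVlt; apply/orP; left; apply/eqP.
have prodE h o : nu R (oS b o h) (oT b o h) F * nu R (oS (~~ b) o h) (oT (~~ b) o h) G *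
    (ans == o)%:R = mean (fun w => mean (fun s => mean (fun s' =>
    mean (fun w' => mean (fun t => mean (fun t' =>
      ((oS b o h (planted F w s))%:R * (oT b o h (planted F (negf w) s'))%:R) *
      ((oS (~~ b) o h (planted G w' t))%:R * (oT (~~ b) o h (planted G (negf w') t'))%:R) *
      (ans == o)%:R)))))).
  rewrite !nu_meanE -!meanZr; apply: eq_mean => w; rewrite -!meanZr; apply: eq_mean => s.
  rewrite -!meanZr; apply: eq_mean => s'; rewrite -meanZ -meanZr; apply: eq_mean => w'.
  rewrite -meanZ -meanZr; apply: eq_mean => t; rewrite -meanZ -meanZr; apply: eq_mean => t'.
  by [].
under [RHS]eq_bigr do under eq_bigr do rewrite prodE.
do 6 (under [RHS]eq_bigr do rewrite -mean_sum; rewrite -mean_sum; apply: eq_mean => ?).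
by [].
Qed.

End output.
End protocol.
(** * Transcripts of a protocol *)

Section rounds.
Variable T : Type.

(** All bits of a round without delimiters: the strategy tells their senders and where the final
    message begins. *)
Fixpoint code L (t : round T L) (inputs : T * T) : seq bool :=
  match t with
  | Say s f next => let b := f (select s inputs) in b :: code (next b) inputs
  | Send s f next => f (select s inputs)
  end.

(** The default [false] is met only by strings too short to be a round. *)
Fixpoint replay L (t : round T L) (c : seq bool) : seq bool * L :=
  match t with
  | Say s f next => replay (next (head false c)) (behead c)
  | Send s f next => (c, next c)
  end.

Lemma run_roundE L (t : round T L) inputs : run_round inputs t =
  (size (code t inputs), (replay t (code t inputs)).1, (replay t (code t inputs)).2).
Proof. by elim: t => //= s f next ->. Qed.

(* The messages of the first player (if [i]) or of the second one in the round c
   are those that this player sends on input a. *)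
Fixpoint agrees L (i : bool) (t : round T L) (c : seq bool) (a : T) : bool :=
  match t with
  | Say s f next =>
      if c is b :: c' then ((s == i) ==> (f a == b)) && agrees i (next b) c' a else false
  | Send s f next => (s == i) ==> (f a == c)
  end.

(** The rectangle property of a single round. *)
Lemma code_eq L (t : round T L) inputs c :
  (code t inputs == c) = agrees true t c inputs.1 && agrees false t c inputs.2.
Proof.
elim: t c => [s f next IH [|b c]|s f next c] //=; last first.
  by case: s; rewrite /= ?andbT.
rewrite eqseq_cons; case: s; rewrite /= ?andbT -?andbA; case: eqP => [->|_] //=;
  by rewrite ?IH ?andbF.
Qed.

Lemma agrees_code L (t : round T L) inputs i : agrees i t (code t inputs) (select i inputs).
Proof. by have := code_eq t inputs (code t inputs); rewrite eqxx => /esym/andP[]; case: i. Qed.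

Lemma agrees_inj L (t : round T L) c c' a1 a2 :
  agrees true t c a1 -> agrees false t c a2 ->
  agrees true t c' a1 -> agrees false t c' a2 -> c = c'.
Proof.
move=> h1 h2 h3 h4; have := code_eq t (a1, a2) c; have := code_eq t (a1, a2) c'.
by rewrite h1 h2 h3 h4 => /eqP-> /eqP->.
Qed.

End rounds.

Section transcripts.
Variable T : Type.
Implicit Types (cd i : bool) (c : seq bool) (cs : seq (seq bool)).

Definition current k cd :
  strategy T k.+1 (~~ cd) -> strategy T k.+1 cd -> round T (strategy T k false) :=
  match cd with true => fun _ sCD => sCD | false => fun sAB _ => sAB end.

Definition after k cd : strategy T k.+1 (~~ cd) -> strategy T k.+1 cd -> seq bool ->
    strategy T k (~~ ~~ cd) * strategy T k (~~ cd) :=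
  match cd with
  | true => fun sAB sCD c => (sAB (replay sCD c).1, (replay sCD c).2)
  | false => fun sAB sCD c => ((replay sAB c).2, sCD (replay sAB c).1)
  end.

Fixpoint trace (ab_in cd_in : T * T) k cd :
    strategy T k (~~ cd) -> strategy T k cd -> seq (seq bool) :=
  match k with
  | 0 => fun _ _ => [::]
  | j.+1 => fun sAB sCD =>
      let c := code (current sAB sCD) (if cd then cd_in else ab_in) in
      let s := after sAB sCD c in c :: trace ab_in cd_in s.1 s.2
  end.

(** The earlier rounds, oldest first, determine the remaining strategies without the inputs. Past
    the last round only the empty string is accepted, which preserves uniqueness. *)
Fixpoint next_agrees k cd : strategy T k (~~ cd) -> strategy T k cd ->
    seq (seq bool) -> bool -> seq bool -> T -> bool :=
  match k with
  | 0 => fun _ _ _ i c a => c == [::]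
  | j.+1 => fun sAB sCD cs =>
      if cs is c0 :: cs' then
        let s := after sAB sCD c0 in next_agrees s.1 s.2 cs'
      else fun i c a => agrees i (current sAB sCD) c a
  end.

Fixpoint answer k cd : strategy T k (~~ cd) -> strategy T k cd ->
    seq (seq bool) -> player -> T -> bool :=
  match k with
  | 0 => fun sAB sCD _ q a =>
      match q with
      | PA => sAB true a | PB => sAB false a | PC => sCD true a | PD => sCD false a
      end
  | j.+1 => fun sAB sCD cs =>
      let s := after sAB sCD (head [::] cs) in answer s.1 s.2 (behead cs)
  end.

Definition player_input (ab_in cd_in : T * T) (q : player) : T :=
  match q with PA => ab_in.1 | PB => ab_in.2 | PC => cd_in.1 | PD => cd_in.2 end.

Lemma run_trace ab_in cd_in k cd (sAB : strategy T k (~~ cd)) (sCD : strategy T k cd) :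
  (run ab_in cd_in sAB sCD).1 = sumn (map size (trace ab_in cd_in sAB sCD)) /\
  forall q, (run ab_in cd_in sAB sCD).2 q =
    answer sAB sCD (trace ab_in cd_in sAB sCD) q (player_input ab_in cd_in q).
Proof.
elim: k cd sAB sCD => [|k IH] cd sAB sCD; first by split=> //; case.
case: cd sAB sCD => sAB sCD /=.
  rewrite run_roundE /=; have [] := IH false (sAB (replay sCD (code sCD cd_in)).1)
    (replay sCD (code sCD cd_in)).2.
  by case: (run _ _ _ _) => n out /= -> outE.
rewrite run_roundE /=; have [] := IH true (replay sAB (code sAB ab_in)).2
  (sCD (replay sAB (code sAB ab_in)).1).
by case: (run _ _ _ _) => n out /= -> outE.
Qed.

Lemma size_trace ab_in cd_in k cd (sAB : strategy T k (~~ cd)) (sCD : strategy T k cd) :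
  size (trace ab_in cd_in sAB sCD) = k.
Proof. by elim: k cd sAB sCD => //= k IH cd sAB sCD; rewrite IH. Qed.

Lemma next_agrees_trace ab_in cd_in k cd (sAB : strategy T k (~~ cd))
    (sCD : strategy T k cd) j i : (j < k)%N ->
  next_agrees sAB sCD (take j (trace ab_in cd_in sAB sCD)) i
    (nth [::] (trace ab_in cd_in sAB sCD) j)
    (select i (if cd (+) odd j then cd_in else ab_in)).
Proof.
elim: k cd sAB sCD j => // k IH cd sAB sCD [_|j]; first by rewrite /= addbF agrees_code.
rewrite ltnS => jk /=; have := IH (~~ cd) _ _ j jk.
by rewrite addNb addbN; apply.
Qed.

Lemma next_agrees_inj k cd (sAB : strategy T k (~~ cd)) (sCD : strategy T k cd) cs c c' a1 a2 :
  next_agrees sAB sCD cs true c a1 -> next_agrees sAB sCD cs false c a2 ->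
  next_agrees sAB sCD cs true c' a1 -> next_agrees sAB sCD cs false c' a2 -> c = c'.
Proof.
elim: k cd sAB sCD cs => [|k IH] cd sAB sCD [|c0 cs] /=.
- by move=> /eqP-> _ /eqP->.
- by move=> /eqP-> _ /eqP->.
- exact: agrees_inj.
- exact: IH.
Qed.

End transcripts.

(** * Transcripts as sequences over three symbols *)

Section histories.

(* A transcript, newest round first, each round being followed by None. *)
Definition push (c : seq bool) (h : seq (option bool)) := map some c ++ None :: h.

(** The last branch is met only when the sequence ends in a bit, which no transcript does. *)
Fixpoint parse (h : seq (option bool)) : seq (seq bool) :=
  match h with
  | [::] => [::]
  | None :: h' => [::] :: parse h'
  | Some x :: h' => if parse h' is c :: cs then (x :: c) :: cs else [:: [:: x]]
  end.

Definition pop (h : seq (option bool)) := drop (index None h).+1 h.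

Lemma parse_push c h : parse (push c h) = c :: parse h.
Proof. by elim: c => //= x c ->. Qed.

Lemma pop_push c h : pop (push c h) = h.
Proof. by elim: c => [|x c]; rewrite /pop /= ?drop0. Qed.

Definition record_rounds (cs : seq (seq bool)) := foldl (fun h c => push c h) [::] cs.

Lemma record_rounds_rcons cs c : record_rounds (rcons cs c) = push c (record_rounds cs).
Proof. by rewrite /record_rounds foldl_rcons. Qed.

Lemma parse_record_rounds cs : parse (record_rounds cs) = rev cs.
Proof.
elim/last_ind: cs => // cs c IH.
by rewrite record_rounds_rcons parse_push IH rev_rcons.
Qed.

Lemma size_record_rounds cs : size (record_rounds cs) = (sumn (map size cs) + size cs)%N.
Proof.
elim/last_ind: cs => // cs c IH.
rewrite record_rounds_rcons /push size_cat size_map /= IH map_rcons sumn_rcons size_rcons.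
by rewrite !addnS addnAC [(_ + size c)%N]addnC addnA.
Qed.

End histories.

(** * Deterministic protocols on the hard inputs *)

Section deterministic.
Variables (R : realType) (m : nat) (m_gt0 : (0 < m)%N) (l C : nat).
Variable Q : misaligned_protocol m l.+1.
Hypothesis bits_le : forall I, (bits Q I <= C)%N.
Local Notation pmap := {ffun 'I_m -> 'I_m}.
Local Notation cube := {ffun 'I_m * 'I_m -> bool}.
Local Notation N := (C + l.+1)%N.
Local Notation hist := {bseq N of option bool}.
Let z0 := Ordinal m_gt0.
Let sAB : strategy (Defs.family m) l.+1 (~~ true) := strategyAB Q.
Let sCD : strategy (Defs.family m) l.+1 true := strategyCD Q.

Lemma size_pop (h : hist) : (size (pop h) <= N)%N.
Proof. by rewrite size_drop (leq_trans (leq_subr _ _))// size_bseq. Qed.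

Definition hpop (h : hist) : hist := Bseq (size_pop h).

(** The equation rejects malformed sequences, so that a transcript is determined by its prefix and
    its last round. *)
Definition last_agrees i (h : hist) a :=
  let c := head [::] (parse h) in
  (h == push c (hpop h) :> seq _) && next_agrees sAB sCD (rev (parse (hpop h))) i c a.

Fixpoint consistent i j b (h : hist) (a : Defs.family m) : bool :=
  if j is k.+1
  then consistent i k b (hpop h) a && ((b == ~~ odd k) ==> last_agrees i h a)
  else h == [bseq].

Lemma consistent_start b h a :
  (consistent true 0 b h a = (h == [bseq])) * (consistent false 0 b h a = (h == [bseq])).
Proof. by []. Qed.

Lemma consistent_listen j h a :
  (consistent true j.+1 (odd j) h a = consistent true j (odd j) (hpop h) a) *
  (consistent false j.+1 (odd j) h a = consistent false j (odd j) (hpop h) a).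
Proof. by split=> /=; case: (odd j); rewrite andbT. Qed.

(** By [next_agrees_inj] at most one extension of [h] agrees with both inputs; there is none if the
    round does not fit into the length [N]. *)
Lemma consistent_speak j h a1 a2 :
  \sum_(h' | hpop h' == h) (consistent true j.+1 (~~ odd j) h' a1)%:R *
    (consistent false j.+1 (~~ odd j) h' a2)%:R <=
  (consistent true j (~~ odd j) h a1)%:R * (consistent false j (~~ odd j) h a2)%:R :> R.
Proof.
set c1 := consistent true j _ h a1; set c2 := consistent false j _ h a2.
pose ok h' := last_agrees true h' a1 && last_agrees false h' a2.
have termE h' : hpop h' == h -> (consistent true j.+1 (~~ odd j) h' a1)%:R *
    (consistent false j.+1 (~~ odd j) h' a2)%:R = c1%:R * c2%:R * (ok h')%:R :> R.
  move=> /eqP h'h; rewrite /= eqxx /= h'h -!natrM !mulnb /c1 /c2 /ok.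
  by rewrite andbACA.
rewrite (eq_bigr _ termE) -mulr_sumr ler_piMr ?mulr_ge0//.
have ok_inj h1 h2 : hpop h1 == h -> hpop h2 == h -> ok h1 -> ok h2 -> h1 = h2.
  move=> /eqP e1 /eqP e2 /andP[/andP[/eqP v1 n1] /andP[_ n1']].
  move=> /andP[/andP[/eqP v2 n2] /andP[_ n2']].
  apply/val_inj/(etrans v1)/esym/(etrans v2)/esym; rewrite e1 e2; congr (push _ _).
  by rewrite e1 in n1 n1'; rewrite e2 in n2 n2'; exact: (next_agrees_inj n1 n1' n2 n2').
have [h1 /andP[p1 ok1]|none] := pickP [pred h' | (hpop h' == h) && ok h'].
  rewrite (bigD1 h1)//= ok1 big1 ?addr0// => h2 /andP[p2 h21].
  by case: (boolP (ok h2)) h21 => // ok2; rewrite (ok_inj h2 h1)// eqxx.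
by rewrite big1// => h' p'; have := none h'; rewrite /= p' /= => ->.
Qed.

Definition pair_input (I : bhpc m) (b : bool) :=
  if b then (inC I, inD I) else (inA I, inB I).

Lemma consistent_run (I : bhpc m) : exists hs : nat -> hist,
  (forall j b i, (j <= l.+1)%N -> consistent i j b (hs j) (select i (pair_input I b))) /\
  output Q I = answer sAB sCD (rev (parse (hs l.+1))) (output_player Q)
    (player_input (pair_input I false) (pair_input I true) (output_player Q)).
Proof.
pose tr := trace (pair_input I false) (pair_input I true) sAB sCD.
have [bitsE outE] := run_trace (pair_input I false) (pair_input I true) sAB sCD.
have str : size tr = l.+1 by exact: size_trace.
have size_hs j : (j <= l.+1)%N -> (size (record_rounds (take j tr)) <= N)%N.
  move=> jl; rewrite size_record_rounds leq_add ?size_take_min ?str ?geq_minr//.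
  apply: leq_trans (bits_le I); rewrite /bits /execution [leqRHS]bitsE -/tr.
  by rewrite -[in leqRHS](cat_take_drop j tr) map_cat sumn_cat leq_addr.
(* The default value does not occur for j <= l + 1, by [size_hs]. *)
pose hs j : hist := insubd [bseq] (record_rounds (take j tr)).
have hsE j : (j <= l.+1)%N -> hs j = record_rounds (take j tr) :> seq _.
  by move=> jl; rewrite /hs insubdK//; exact: size_hs.
have takeS j : (j < l.+1)%N -> take j.+1 tr = rcons (take j tr) (nth [::] tr j).
  by move=> jl; rewrite (take_nth [::]) ?str.
exists hs; split; last first.
  rewrite hsE// parse_record_rounds revK take_oversize ?str//.
  exact: outE.
elim=> [|j IH] b i jl.
  by apply/eqP/val_inj/(etrans (hsE _ jl)); rewrite take0.
have e1 := hsE _ jl; have e2 := hsE _ (ltnW jl).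
have popE : hpop (hs j.+1) = hs j.
  by apply/val_inj/(etrans _ (esym e2)); rewrite /= e1 takeS// record_rounds_rcons pop_push.
rewrite /= popE IH ?(ltnW jl)//=; apply/implyP => /eqP bj.
rewrite /last_agrees popE e1 e2 takeS// record_rounds_rcons parse_push.
rewrite parse_record_rounds revK eqxx /= bj.
have := next_agrees_trace (pair_input I false) (pair_input I true) sAB sCD i jl.
by rewrite /= /pair_input; case: (odd j).
Qed.

Definition hard_input (F : pmap) (w s s' : cube) (G : pmap) (w' t t' : cube) : bhpc m :=
  Bhpc (planted_inter F w s s') (planted_inter G w' t t').

Let b := odd l.

(** [F] is given to the side that makes the last step. *)
Definition hard_instance (F G : pmap) (w s s' w' t t' : cube) : bhpc m :=
  if b then hard_input G w' t t' F w s s' else hard_input F w s s' G w' t t'.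

Lemma pointer_walk F G w s s' w' t t' j :
  pointer m_gt0 (hard_instance F G w s s' w' t t') j = head z0 (walk z0 j b F G).
Proof.
elim: j => //= j ->; rewrite /hard_instance.
by case: (b); case: (odd j).
Qed.

(** Planted inputs satisfy the promise, so their run has at most [C] bits and its transcript is
    among the terms. *)
Lemma cover_consistent j d (F G : pmap) (w s s' w' t t' : cube) : (j <= l.+1)%N ->
  \sum_h (consistent true j d h (planted F w s))%:R *
    (consistent false j d h (planted F (negf w) s'))%:R *
   ((consistent true j (~~ d) h (planted G w' t))%:R *
    (consistent false j (~~ d) h (planted G (negf w') t'))%:R) = 1 :> R.
Proof.
move=> jl; apply/eqP; rewrite eq_le; apply/andP; split.
  exact: (@sum_acc_le1 R m hist [bseq] hpop (consistent true) (consistent false)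
    consistent_start consistent_listen consistent_speak).
pose I := if d then hard_input G w' t t' F w s s' else hard_input F w s s' G w' t t'.
have [hs [cons _]] := consistent_run I.
rewrite (bigD1 (hs j))//=; apply: ler_wpDr; first by apply: sumr_ge0 => h _; rewrite !mulr_ge0.
have := cons j d true jl; have := cons j d false jl.
have := cons j (~~ d) true jl; have := cons j (~~ d) false jl.
rewrite /I /pair_input; case: (d) => /= -> -> -> ->; by rewrite !mulr1.
Qed.

(** There are at most 4^(N+1) sequences of length at most [N] over three symbols, and ln 2 <= 1. *)
Lemma ln_card_hist_le : ln ((#|{: hist}| * 2 ^ m)%:R : R) <= (2 * N + 2 + m)%:R.
Proof.
have card4 : (#|{: hist}| * 2 ^ m <= 2 ^ (2 * N + 2 + m))%N.
  rewrite expnD leq_mul2r; apply/orP; right.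
  rewrite card_bseq card_option card_bool (_ : 2 * N + 2 = 2 * N.+1)%N; last by lia.
  rewrite expnM; move: (C + _)%N => n; elim: n => [|n IH]; first by rewrite big_ord1.
  have h3 : (3 ^ n.+1 <= (2 ^ 2) ^ n.+1)%N by rewrite leq_exp2r.
  rewrite big_ord_recr/= [leqRHS]expnS (leq_trans (leq_add IH h3))//.
  by rewrite addnn -mul2n leq_mul2r orbT.
have [H0|H0] := posnP (#|{: hist}| * 2 ^ m)%N; first by rewrite H0 ln0.
apply: (@le_trans _ _ (ln ((2 ^ (2 * N + 2 + m))%:R))).
  by rewrite ler_ln ?posrE ?ltr0n ?expn_gt0// ler_nat.
rewrite natrX lnXn// -[leLHS]mulr_natl -[leRHS]mulr1; apply: ler_wpM2l => //.
exact: ln2_le1.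
Qed.

Lemma success_le (lam : R) : 0 < lam ->
  mean (fun F => mean (fun G => mean (fun w => mean (fun s => mean (fun s' =>
    mean (fun w' => mean (fun t => mean (fun t' =>
    let I := hard_instance F G w s s' w' t t' in
    (output Q I == bhpc_answer m_gt0 I l.+1)%:R)))))))) <=
  2^-1 + (2 * m%:R)^-1 + 2 / lam +
  lam / 2 * (8 * l.+1%:R / m%:R *
    (2 * l.+1%:R + m%:R^-1 * (576 * ((2 * N + 2 + m)%:R + 1))) + 1152 / m%:R).
Proof.
move=> lam0.
pose fst := if output_player Q is (PA | PC) then true else false.
pose side := if output_player Q is (PC | PD) then true else false.
pose O (h : hist) := [ffun a : {ffun 'I_m -> {set 'I_m}} =>
  answer sAB sCD (rev (parse h)) (output_player Q) a].
pose out (a1 a2 c1 c2 : Defs.family m) :=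
  (run (if b then (c1, c2) else (a1, a2)) (if b then (a1, a2) else (c1, c2)) sAB sCD).2
    (output_player Q).
have outE F G w s s' w' t t' : output Q (hard_instance F G w s s' w' t t') =
    out (planted F w s) (planted F (negf w) s') (planted G w' t) (planted G (negf w') t').
  by rewrite /output /execution /out /hard_instance; case: (b).
have := @output_le R m z0 hist [bseq] hpop (consistent true) (consistent false) l.+1
  consistent_start consistent_listen consistent_speak cover_consistent l side fst O erefl
  lam out lam0.
rewrite -/b => le; apply: le_trans (le_trans (le _) _).
- do 8 (apply: ler_mean => ?).
  by rewrite /= outE /bhpc_answer pointer_walk.
- move=> F G w s s' w' t t' a1 a2 c1 c2.
  pose I := hard_instance F G w s s' w' t t'.
  have [hs [cons outI]] := consistent_run I.
  exists (hs l.+1); split.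
  + have := cons l.+1 b true (leqnn _); have := cons l.+1 b false (leqnn _).
    by rewrite /I /hard_instance /pair_input; case: (b) => /= -> ->.
  + have := cons l.+1 (~~ b) true (leqnn _); have := cons l.+1 (~~ b) false (leqnn _).
    by rewrite /I /hard_instance /pair_input; case: (b) => /= -> ->.
  + rewrite -outE outI ffunE; congr (answer _ _ _ _ _).
    rewrite /I /hard_instance /pair_input /side /fst.
    by case: (output_player Q); case: (b).
rewrite lerD2l ler_wpM2l ?divr_ge0 ?(ltW lam0)// lerD2r ler_wpM2l ?divr_ge0 ?mulr_ge0//.
rewrite lerD2l ler_wpM2l ?invr_ge0//; apply: (ler_wpM2l (ler0n R 576)).
by rewrite lerD2r; exact: ln_card_hist_le.
Qed.

End deterministic.
(** * Randomized protocols *)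

(** The easy direction of Yao's principle, by integrating over the coins. *)
Lemma success_average (R : realType) d (Om : measurableType d) (P : probability Om R)
    (Th : finType) (A : Th -> set Om) (p q : R) : (0 < #|Th|)%N ->
  (forall th, measurable (A th) /\ (p%:E <= P (A th))%E) ->
  (forall w, mean (fun th => (\1_(A th) w : R)) <= q) -> p <= q.
Proof.
move=> Th0 hA avg; have n0 : 0 < #|Th|%:R :> R by rewrite ltr0n.
rewrite -(ler_pM2r n0) -lee_fin.
have -> : (p * #|Th|%:R)%:E = (\sum_(th : Th) p%:E)%E.
  by rewrite sumEFin sumr_const mulr_natr.
apply: (@le_trans _ _ (\sum_(th : Th) \int[P]_w (\1_(A th) w)%:E)%E).
  apply: lee_sum => th _; have [mA pA] := hA th.
  by rewrite integral_indic// setIT.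
rewrite -ge0_integral_sum// => [|th]; last first.
  by apply/measurable_EFinP/measurable_indic; have [] := hA th.
apply: (@le_trans _ _ (\int[P]_w (cst (q * #|Th|%:R)%:E w))%E).
  apply: ge0_le_integral => //.
  - by move=> w _; apply: sume_ge0 => th _; rewrite lee_fin.
  - apply: emeasurable_sum => th; apply/measurable_EFinP/measurable_indic.
    by have [] := hA th.
  - move=> w _; rewrite /= sumEFin lee_fin; have := avg w.
    by rewrite meanE ler_pdivrMr.
rewrite (_ : \int[P]_w _ = (q * #|Th|%:R)%:E * P setT)%E; last exact: integral_cst.
by rewrite probability_setT mule1.
Qed.

Lemma cost_bound (R : realType) (p lam : R) (m r C : nat) (m_gt0 : (0 < m)%N)
    d (Om : measurableType d) (P : probability Om R)
    (Q : Om -> misaligned_protocol m r) : 0 < lam -> (0 < r)%N ->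
  solves_bhpc Q m_gt0 P p -> (forall w I, (bits (Q w) I <= C)%N) ->
  p <= 2^-1 + (2 * m%:R)^-1 + 2 / lam + lam / 2 * (8 * r%:R / m%:R *
    (2 * r%:R + m%:R^-1 * (576 * ((2 * (C%:R + r%:R) + 2 + m%:R) + 1))) + 1152 / m%:R).
Proof.
case: r Q => // l Q lam0 _ solves bitsC.
have -> : 2 * (C%:R + l.+1%:R) + 2 + m%:R = (2 * (C + l.+1) + 2 + m)%:R :> R.
  by rewrite natrD (natrD _ _ 2) natrM natrD.
pose cube := {ffun 'I_m * 'I_m -> bool}.
pose pmap := {ffun 'I_m -> 'I_m}.
pose Th := (pmap * pmap * cube * cube * cube * cube * cube * cube)%type.
pose inst (th : Th) := hard_instance l th.1.1.1.1.1.1.1 th.1.1.1.1.1.1.2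
  th.1.1.1.1.1.2 th.1.1.1.1.2 th.1.1.1.2 th.1.1.2 th.1.2 th.2.
apply: (@success_average R d Om P Th
  (fun th => [set w | output (Q w) (inst th) = bhpc_answer m_gt0 (inst th) l.+1])).
- have f0 : pmap := [ffun i => i]; have c0 : cube := [ffun=> false].
  by apply/card_gt0P; exists (f0, f0, c0, c0, c0, c0, c0, c0).
- by move=> th; exact: solves.
move=> w; have := success_le m_gt0 (bitsC w) lam0.
rewrite !mean_pair; apply: le_trans; apply: ler_mean => th.
rewrite indicE /=; case: (boolP (_ \in _)) => [/set_mem /= ->|_]; first by rewrite eqxx.
exact: ler0n.
Qed.

(** The budget: 2 / lam = eps / 4 for lam = 8 / eps, the choice of [c] makes the communication term
    eps / 8, and the terms in [u] take at most eps / 4. *)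
Lemma bound_small (R : realType) (eps c u M r C : R) : 0 < eps ->
  c = eps ^+ 2 / (32 * 96 * 96) -> 1 <= M -> 1 <= r -> r ^+ 2 = u * M -> 0 <= C ->
  r * C <= c * M ^+ 2 -> u * (1 + (300 * 400) / eps) <= eps / 4 ->
  2^-1 + (2 * M)^-1 + 2 / (8 / eps) + 8 / eps / 2 * (8 * r / M *
    (2 * r + M^-1 * (576 * ((2 * (C + r) + 2 + M) + 1))) + 1152 / M) < 2^-1 + eps.
Proof.
move=> e0 cE M1 r1 ru C0 rC ue.
have M0 : 0 < M by lra.
have iM : 0 < M^-1 by rewrite invr_gt0.
have uE : u = r ^+ 2 / M by rewrite ru mulfK// gt_eqF.
have r2 : 1 <= r ^+ 2 by rewrite exprn_ege1.
have Mu : M^-1 <= u by rewrite uE ler_peMl// ltW.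
have h1 : (2 * M)^-1 <= u by rewrite invfM; lra.
have h2 : 2 / (8 / eps) = eps / 4 by field; rewrite gt_eqF.
have h3 : 8 * r / M * (2 * r + M^-1 * (576 * ((2 * (C + r) + 2 + M) + 1))) =
    16 * u + (96 * 96) * (r * C / M ^+ 2) + (48 * 96) * ((2 * r ^+ 2 + 3 * r + r * M) / M ^+ 2).
  by rewrite uE; field; rewrite gt_eqF.
have h4 : r * C / M ^+ 2 <= c by rewrite ler_pdivrMr ?exprn_gt0.
have h5 : (2 * r ^+ 2 + 3 * r + r * M) / M ^+ 2 <= 6 * u.
  rewrite ler_pdivrMr ?exprn_gt0//.
  have -> : 6 * u * M ^+ 2 = 6 * r ^+ 2 * M by rewrite ru; ring.
  have rr : r <= r ^+ 2 by rewrite expr2 ler_peMr//; lra.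
  have rM : r * M <= r ^+ 2 * M by rewrite ler_pM2r.
  have rM' : r ^+ 2 <= r ^+ 2 * M by rewrite ler_peMr// sqr_ge0.
  nra.
have inner : 8 * r / M * (2 * r + M^-1 * (576 * ((2 * (C + r) + 2 + M) + 1))) + 1152 / M
    <= (96 * 96) * c + (300 * 100) * u by rewrite h3; lra.
have e4 : 0 <= 8 / eps / 2 by rewrite !divr_ge0 ?ltW.
have := ler_wpM2l e4 inner.
have -> : 8 / eps / 2 * ((96 * 96) * c + (300 * 100) * u) = eps / 8 + u * ((300 * 400) / eps).
  by rewrite cE; field; rewrite gt_eqF.
rewrite h2; move: ue; rewrite mulrDr mulr1.
move: (u * ((300 * 400) / eps)) (8 / eps / 2 * _) => x y.
move=> *; lra.
Qed.

Theorem theorem4p2 (R : realType) (p : R) (hp : 2^-1 < p) :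
  exists2 c : R, 0 < c &
  forall r : nat -> nat,
    (forall m, (0 < r m)%N) ->
    (fun m => (r m)%:R : R) =o_\oo (fun m => Num.sqrt m%:R : R) ->
    \forall m \near \oo,
      forall (m_gt0 : (0 < m)%N) (d : measure_display) (Om : measurableType d)
             (P : probability Om R) (Q : Om -> misaligned_protocol m (r m)),
        solves_bhpc Q m_gt0 P p ->
        ((c * (m%:R ^+ 2 / (r m)%:R))%:E <= comm_cost R Q)%E.
Proof.
pose eps := p - 2^-1; have e0 : 0 < eps by rewrite subr_gt0.
exists (eps ^+ 2 / (32 * 96 * 96)); first by rewrite divr_gt0 ?exprn_gt0 ?mulr_gt0.
set c := eps ^+ 2 / _ => r r0 ro.
have k0 : 0 < 1 + (300 * 400) / eps.
  apply: (ltr_pwDl ltr01); apply: divr_ge0; last exact: ltW.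
  by apply: mulr_ge0; exact: ler0n.
pose eta := eps / 4 / (1 + (300 * 400) / eps).
have eta0 : 0 < eta by rewrite !divr_gt0.
(* The hypothesis on r is used with the factor sqrt eta, which yields r^2 / m <= eta. *)
have s0 : 0 < Num.sqrt eta by rewrite sqrtr_gt0.
move/eqoP: ro => /(_ _ s0); apply: filterS => m rm m_gt0 d Om P Q solves.
have c0 : 0 < c by rewrite divr_gt0 ?exprn_gt0 ?mulr_gt0.
have M1 : 1 <= m%:R :> R by rewrite ler1n.
have r1 : 1 <= (r m)%:R :> R by rewrite ler1n.
have M0 : 0 < m%:R :> R by lra.
have R0 : 0 < (r m)%:R :> R by lra.
rewrite leNgt; apply/negP => small.
(* If the cost is below [x], then the numbers of bits, being integers, are at most its floor. *)
pose x := c * (m%:R ^+ 2 / (r m)%:R); pose C := Num.truncn x.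
have x0 : 0 <= x by rewrite mulr_ge0 ?divr_ge0 ?sqr_ge0 ?ltW.
have Cx : C%:R <= x by rewrite -truncn_ge_nat.
have bitsC w I : (bits (Q w) I <= C)%N.
  rewrite truncn_ge_nat//; rewrite -lee_fin ltW//; apply: le_lt_trans small.
  by apply: ereal_sup_ubound; exists (w, I).
pose u : R := (r m)%:R ^+ 2 / m%:R.
have lam0 : 0 < 8 / eps by rewrite divr_gt0.
have := cost_bound lam0 (r0 m) solves bitsC.
apply/negP; rewrite -ltNge.
have -> : p = 2^-1 + eps by rewrite /eps addrC subrK.
apply: (@bound_small R eps c u) => //.
- by rewrite /u divfK// gt_eqF.
- have -> : c * m%:R ^+ 2 = (r m)%:R * x by rewrite /x; field; rewrite gt_eqF.
  by rewrite ler_wpM2l ?(ltW R0).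
- rewrite -ler_pdivlMr// -/eta /u ler_pdivrMr//.
  move: rm; rewrite !ger0_norm ?sqrtr_ge0// => rm.
  have : (r m)%:R ^+ 2 <= (Num.sqrt eta * Num.sqrt m%:R) ^+ 2 :> R.
    by rewrite ler_pXn2r ?nnegrE ?mulr_ge0 ?sqrtr_ge0.
  by rewrite exprMn !sqr_sqrtr// ltW.
Qed.
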